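(* Suppose $(X,\mathcal{A},\mu)$ is a Peano-Jordan complete charge space with null sets $\mathcal{N}$ and $\mathcal{A}^{\prime}$ is a sub-field of $\mathcal{A}$. Let $p \in \{0\} \cup [1,\infty)$. Then $L_p(X,\mathcal{A}^{\prime},\mu)$ is a dense subspace of $L_p(X,\alpha(\mathcal{A}^{\prime} \cup \mathcal{N}),\mu)$. Moreover, the following statements hold. 1. $L_p(X,\mathcal{A}^{\prime},\mu) = L_p(X,\alpha(\mathcal{A}^{\prime} \cup \mathcal{N}),\mu)$ if and only if $\mathcal{N} \subseteq \overline{\mathcal{A}^{\prime}}$. 2. The following statements are logically equivalent: (a) $\mathcal{L}_p(X,\mathcal{A}^{\prime},\mu) \cong \mathcal{L}_p(X,\alpha(\mathcal{A}^{\prime} \cup \mathcal{N}),\mu)$ (isometric vector space isomorphism) with the isomorphism given by $[f]_{\mathcal{A}^{\prime}} \mapsto [f]_{\alpha(\mathcal{A}^{\prime} \cup \mathcal{N})}$. (b) $\overline{\alpha(\mathcal{A}^{\prime} \cup \mathcal{N})} = \alpha(\overline{\mathcal{A}^{\prime}} \cup \mathcal{N})$.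
   Context: A field of subsets of a set $X$ is a collection containing $\emptyset$ and closed under complements and finite unions. A charge $\mu$ on a field $\mathcal{A}$ is a function $\mu:\mathcal{A}\to[0,\infty)$ with $\mu(\emptyset)=0$ and $\mu(A\cup B)=\mu(A)+\mu(B)$ for disjoint $A,B\in\mathcal{A}$ (all charges are non-negative and bounded). $(X,\mathcal{A},\mu)$ is then a charge space. For a sub-field $\mathcal{B}\subseteq\mathcal{A}$, $(X,\mathcal{B},\mu)$ denotes the charge space with $\mu$ restricted to $\mathcal{B}$. For a charge space $(X,\mathcal{B},\mu)$: outer charge $\mu^*_{\mathcal{B}}(A):=\inf\{\mu(B): B\in\mathcal{B}, A\subseteq B\}$; null sets are the $A\subseteq X$ with $\mu^*_{\mathcal{B}}(A)=0$ (here $\mathcal{N}=\{A\subseteq X:\mu^*_{\mathcal{A}}(A)=0\}$); Peano-Jordan completion $\overline{\mathcal{B}}:=\{A\subseteq X:\forall\epsilon>0\ \exists B,C\in\mathcal{B}, B\subseteq A\subseteq C, \mu(C\setminus B)<\epsilon\}$, with $\overline{\mu}(A):=\inf\{\mu(C):A\subseteq C\in\mathcal{B}\}$; the space is Peano-Jordan complete if $\overline{\mathcal{B}}=\mathcal{B}$ (in which case it contains its null sets). $\alpha(\mathcal{C})$ is the smallest field of subsets of $X$ containing $\mathcal{C}$. $f_n\to f$ hazily (w.r.t. $\mathcal{B}$) if for every $\epsilon>0$, $\mu^*_{\mathcal{B}}(\{x:|f_n(x)-f(x)|>\epsilon\})\to 0$. A simple function is $\sum_{k=1}^K c_kI_{A_k}$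 with $\{A_1,\dots,A_K\}\subset\mathcal{B}$ a finite partition of $X$; its integral is $\sum_kc_k\mu(A_k)$. $f:X\to\mathbb{R}$ is $T_1$-measurable if some sequence of simple functions converges hazily to $f$; it is integrable if such a sequence can be chosen with $\int|f_n-f_m|d\mu\to0$, and then $\int fd\mu:=\lim\int f_nd\mu$ (well defined). $L_0(X,\mathcal{B},\mu)$ is the set of $T_1$-measurable functions, with pseudometric $d_{\mathcal{B}}(f,g):=\inf\{\epsilon>0:\mu^*_{\mathcal{B}}(\{x:|f(x)-g(x)|>\epsilon\})<\epsilon\}$. For $p\in[1,\infty)$, $L_p(X,\mathcal{B},\mu)$ is the vector space of $T_1$-measurable $f$ with $|f|^p$ integrable, with pseudonorm $\|f\|_p=(\int|f|^pd\mu)^{1/p}$. $\mathcal{L}_p(X,\mathcal{B},\mu)$ is the quotient of $L_p(X,\mathcal{B},\mu)$ by the relation $\|f-g\|_p=0$ ($p\ge1$) or $d_{\mathcal{B}}(f,g)=0$ ($p=0$), with the induced norm or metric; $[f]_{\mathcal{B}}$ is the class of $f$. *)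

(* Defs.v *)
From HB Require Import structures.
From mathcomp Require Import all_boot all_order all_algebra.
From mathcomp Require Import all_classical all_reals all_analysis.

Set Implicit Arguments.
Unset Strict Implicit.
Unset Printing Implicit Defensive.

Import Order.TTheory GRing.Theory Num.Theory.
Import numFieldNormedType.Exports.

Local Open Scope classical_set_scope.
Local Open Scope ring_scope.

Definition field_of_sets (X : Type) (F : set (set X)) : Prop :=
  [/\ F set0, setC_closed F & setU_closed F].

Definition field_generated (X : Type) (C : set (set X)) : set (set X) :=
  smallest (@field_of_sets X) C.

(* A charge is represented by a function on all subsets of X, of which only the
   values on the field F are constrained; the restriction of a charge to a
   sub-field is thus the same function mu.  Every notion below that depends on
   a field F evaluates mu on members of F only. *)
Definition is_charge (X : Type) (R : realType) (F : set (set X))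
    (mu : set X -> R) : Prop :=
  [/\ mu set0 = 0,
      (forall A, F A -> 0 <= mu A) &
      (forall A B, F A -> F B -> A `&` B = set0 ->
         mu (A `|` B) = mu A + mu B)].

Definition charge_space (X : Type) (R : realType) (F : set (set X))
    (mu : set X -> R) : Prop :=
  field_of_sets F /\ is_charge F mu.

Definition outer_charge (X : Type) (R : realType) (F : set (set X))
    (mu : set X -> R) (A : set X) : R :=
  inf [set mu B | B in [set B | F B /\ A `<=` B]].

Definition null_sets (X : Type) (R : realType) (F : set (set X))
    (mu : set X -> R) : set (set X) :=
  [set A | outer_charge F mu A = 0].

Definition PJ_completion (X : Type) (R : realType) (F : set (set X))
    (mu : set X -> R) : set (set X) :=
  [set A | forall e : R, 0 < e ->
     exists B C, [/\ F B, F C, B `<=` A, A `<=` C & mu (C `\` B) < e]].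

Definition PJ_complete (X : Type) (R : realType) (F : set (set X))
    (mu : set X -> R) : Prop :=
  PJ_completion F mu = F.

Definition hazy_cvg (X : Type) (R : realType) (F : set (set X))
    (mu : set X -> R) (u : nat -> X -> R) (f : X -> R) : Prop :=
  forall e : R, 0 < e ->
    outer_charge F mu [set x | e < `|u n x - f x|] @[n --> \oo] --> (0 : R).

(* f is the simple function \sum_k c_k I_(A_k).  Parts of the partition may be
   empty, which changes neither the functions nor their integrals. *)
Definition simple_repr (X : Type) (R : realType) (F : set (set X))
    (f : X -> R) (K : nat) (c : 'I_K -> R) (A : 'I_K -> set X) : Prop :=
  [/\ (forall k, F (A k)), trivIset setT A, \bigcup_k A k = setT &
      f = \sum_(k < K) c k *: (\1_(A k) : X -> R)].

Definition is_simple (X : Type) (R : realType) (F : set (set X))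
    (f : X -> R) : Prop :=
  exists (K : nat) (c : 'I_K -> R) (A : 'I_K -> set X), simple_repr F f c A.

(* For F a field and mu a charge on it, the value does not depend on the
   representation.  It is 0 by convention when
   f is not simple. *)
Definition simple_integral (X : Type) (R : realType) (F : set (set X))
    (mu : set X -> R) (f : X -> R) : R :=
  xget 0 [set v | exists (K : nat) (c : 'I_K -> R) (A : 'I_K -> set X),
    simple_repr F f c A /\ v = \sum_(k < K) c k * mu (A k)].

Definition T1_measurable (X : Type) (R : realType) (F : set (set X))
    (mu : set X -> R) (f : X -> R) : Prop :=
  exists u : nat -> X -> R, (forall n, is_simple F (u n)) /\ hazy_cvg F mu u f.

Definition determining_sequence (X : Type) (R : realType) (F : set (set X))
    (mu : set X -> R) (f : X -> R) (u : nat -> X -> R) : Prop :=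
  [/\ (forall n, is_simple F (u n)), hazy_cvg F mu u f &
      forall e : R, 0 < e -> exists N : nat, forall n m : nat,
        (N <= n)%N -> (N <= m)%N ->
        simple_integral F mu (fun x => `|u n x - u m x|) < e].

Definition charge_integrable (X : Type) (R : realType) (F : set (set X))
    (mu : set X -> R) (f : X -> R) : Prop :=
  exists u, determining_sequence F mu f u.

(* For F a field and mu a charge on it, the limit exists and does not depend on
   the determining sequence.  The value is 0 by
   convention when f is not integrable. *)
Definition charge_integral (X : Type) (R : realType) (F : set (set X))
    (mu : set X -> R) (f : X -> R) : R :=
  xget 0 [set v | exists2 u, determining_sequence F mu f u &
    simple_integral F mu (u n) @[n --> \oo] --> v].

Definition Lp (X : Type) (R : realType) (F : set (set X)) (mu : set X -> R)
    (p : R) : set (X -> R) :=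
  if p == 0 then [set f | T1_measurable F mu f]
  else [set f | T1_measurable F mu f /\
                charge_integrable F mu (fun x => `|f x| `^ p)].

Definition L0_dist (X : Type) (R : realType) (F : set (set X))
    (mu : set X -> R) (f g : X -> R) : R :=
  inf [set e : R | 0 < e /\
         outer_charge F mu [set x | e < `|f x - g x|] < e].

Definition Lp_norm (X : Type) (R : realType) (F : set (set X))
    (mu : set X -> R) (p : R) (f : X -> R) : R :=
  charge_integral F mu (fun x => `|f x| `^ p) `^ p^-1.

Definition Lp_dist (X : Type) (R : realType) (F : set (set X))
    (mu : set X -> R) (p : R) (f g : X -> R) : R :=
  if p == 0 then L0_dist F mu f g else Lp_norm F mu p (f - g).

(* M with pseudometric dM is a dense subspace of L with pseudometric d: a linear
   subspace whose own pseudometric is the restriction of d. *)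
Definition dense_subspace (R : realType) (V : lmodType R)
    (M : set V) (dM : V -> V -> R) (L : set V) (d : V -> V -> R) : Prop :=
  [/\ M `<=` L,
      GRing.submod_closed (mem M),
      (forall f g, M f -> M g -> dM f g = d f g) &
      (forall f, L f -> forall e : R, 0 < e -> exists2 g, M g & d f g < e)].

(* The quotient of L by the relation d f g = 0, with its elements represented as
   subsets of L. *)
Definition qclass (R : realType) (V : lmodType R)
    (L : set V) (d : V -> V -> R) (f : V) : set V :=
  [set g | L g /\ d f g = 0].

Definition quotient (R : realType) (V : lmodType R)
    (L : set V) (d : V -> V -> R) : set (set V) :=
  [set qclass L d f | f in L].

(* On classes, the operations are given by representatives: the unions below are
   over sets that all coincide, and the infimum is that of a single value. *)
Definition qadd (R : realType) (V : lmodType R)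
    (L : set V) (d : V -> V -> R) (U W : set V) : set V :=
  \bigcup_(f in U) \bigcup_(g in W) qclass L d (f + g).

Definition qscale (R : realType) (V : lmodType R)
    (L : set V) (d : V -> V -> R) (a : R) (U : set V) : set V :=
  \bigcup_(f in U) qclass L d (a *: f).

Definition qdist (R : realType) (V : lmodType R)
    (d : V -> V -> R) (U W : set V) : R :=
  inf [set d f g | f in U & g in W].

Definition isometric_iso (R : realType) (V : lmodType R)
    (L : set V) (d : V -> V -> R) (L' : set V) (d' : V -> V -> R)
    (Phi : set V -> set V) : Prop :=
  [/\ set_bij (quotient L d) (quotient L' d') Phi,
      (forall U W, quotient L d U -> quotient L d W ->
         Phi (qadd L d U W) = qadd L' d' (Phi U) (Phi W)),
      (forall a U, quotient L d U ->
         Phi (qscale L d a U) = qscale L' d' a (Phi U)) &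
      (forall U W, quotient L d U -> quotient L d W ->
         qdist d' (Phi U) (Phi W) = qdist d U W)].

(* Main.v *)
Require Import Defs.
From HB Require Import structures.
From mathcomp Require Import all_boot all_order all_algebra.
From mathcomp Require Import all_classical all_reals all_analysis.
From mathcomp Require Import ring lra.

Set Implicit Arguments.
Unset Strict Implicit.
Unset Printing Implicit Defensive.

Import Order.TTheory GRing.Theory Num.Theory.
Import numFieldNormedType.Exports.

Local Open Scope classical_set_scope.
Local Open Scope ring_scope.

(* All fields involved lie in A, which contains the null sets and the Peano-
   Jordan completions of its subfields. The integral of a non-negative
   function is a lower integral that ignores null sets and hence does not
   depend on the field; so distances over A' and over B = alpha(A' u N)
   agree, and f and g are at distance 0 exactly when f - g is null. A set of
   B differs from a set of A' by a null set, hence so do simple functions,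
   and these are dense. An indicator is T1-measurable exactly when its set
   lies in the completion, because for a T1-measurable f every interval
   contains some t with {f > t} in the completion.

   In part 2, a representative over A' of the indicator of a set E of the
   completion of B has a level set in the completion of A' that equals E up
   to a null set, which gives (b). Conversely (b) turns the level sets of f
   in L_p(B) into sets of the completion of A', hence yields simple
   functions s_n over it that are 2^-n-close to f, up to null sets, off sets
   T_n decreasing in charge to 0. The null sets accumulate, so s_n need not
   converge; clipping s_(n+1) to within 2 * 2^-n of its clipped predecessor
   off T_n changes it on a null set only and forces uniform convergence off
   each T_n. *)

(** * Simple functions over a field of sets *)

Section FieldOfSets.
Variables (X : Type) (F : set (set X)).
Hypothesis fF : field_of_sets F.

Lemma fset0 : F set0. Proof. by case: fF. Qed.

Lemma fsetC E : F E -> F (~` E). Proof. by case: fF => _ + _; apply. Qed.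

Lemma fsetU D E : F D -> F E -> F (D `|` E).
Proof. by case: fF => _ _; apply. Qed.

Lemma fsetT : F setT. Proof. by rewrite -setC0; exact/fsetC/fset0. Qed.

Lemma fsetI D E : F D -> F E -> F (D `&` E).
Proof.
move=> FD FE; rewrite -(setCK (_ `&` _)) setCI.
by apply/fsetC/fsetU; exact: fsetC.
Qed.

Lemma fsetD D E : F D -> F E -> F (D `\` E).
Proof. by move=> FD FE; rewrite setDE; apply: fsetI => //; exact: fsetC. Qed.

(* A finite partition of X into members of F, encoded by the map sending each
   point to the index of its part. *)
Definition flab (I : finType) (lab : X -> I) := forall i, F (lab @^-1` [set i]).

Lemma flab_mem (I : finType) (lab : X -> I) (s : seq I) :
  flab lab -> F [set x | lab x \in s].
Proof.
move=> Flab; elim: s => [|i s IHs].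
  rewrite (_ : [set _ | _] = set0); first exact: fset0.
  by apply/seteqP; split.
rewrite (_ : [set _ | _] = lab @^-1` [set i] `|` [set x | lab x \in s]).
  exact: fsetU.
apply/seteqP; split => x /=.
  by rewrite inE => /predU1P.
by rewrite inE => -[->|->]; rewrite ?eqxx ?orbT.
Qed.

Lemma flab_pre (I : finType) (lab : X -> I) (P : pred I) :
  flab lab -> F [set x | P (lab x)].
Proof.
move=> Flab; rewrite (_ : [set _ | _] = [set x | lab x \in enum P]).
  exact: flab_mem.
by apply/seteqP; split => x /=; rewrite mem_enum.
Qed.

Lemma flab_pair (I J : finType) (lab : X -> I) (lab' : X -> J) :
  flab lab -> flab lab' -> flab (fun x => (lab x, lab' x)).
Proof.
move=> Flab Flab' [i j].
rewrite (_ : _ @^-1` _ = (lab @^-1` [set i]) `&` (lab' @^-1` [set j])).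
  exact: fsetI.
by apply/seteqP; split => x /= [-> ->].
Qed.

Lemma scale_indicE (R : realType) (a : R) (D : set X) x :
  (a *: (\1_D : X -> R)) x = a * (x \in D)%:R.
Proof. by rewrite -indicE. Qed.

(** With labels, pointwise operations become compositions, and the bookkeeping of sums of indicators
    is confined to this equivalence. *)
Lemma is_simpleP (R : realType) (f : X -> R) : is_simple F f <->
  exists (I : finType) (lab : X -> I) (c : I -> R), flab lab /\ f = c \o lab.
Proof.
split=> [[K [c [D [FD tD UD ->]]]]|[I [lab [c [Flab ->]]]]].
  have /choice[lab labP] : forall x, exists k, D k x.
    move=> x; have : [set: X] x by [].
    by rewrite -UD => -[k _ Dk]; exists k.
  have labD k x : D k x -> lab x = k.
    by move=> Dkx; apply: tD => //; exists x; split.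
  exists 'I_K, lab, c; split.
    move=> k; rewrite (_ : _ @^-1` _ = D k)//.
    by apply/seteqP; split => x /= => [<-|/labD].
  apply/funext => x /=; rewrite fct_sumE (bigD1 (lab x))//= big1 ?addr0.
    by rewrite scale_indicE (mem_set (labP x)) /= mulr1.
  move=> k kx; rewrite scale_indicE memNset ?mulr0//=.
  by move=> /labD/eqP; rewrite eq_sym (negPf kx).
exists #|I|, (c \o enum_val), (fun k => lab @^-1` [set enum_val k]); split.
- by move=> k; exact: Flab.
- move=> i j _ _ [x [/= -> /enum_val_inj]]; exact.
- rewrite -subTset => x _; exists (enum_rank (lab x)) => //=.
  by rewrite enum_rankK.
- apply/funext => x /=; rewrite fct_sumE.
  rewrite (bigD1 (enum_rank (lab x)))//= big1 ?addr0.
    by rewrite scale_indicE mem_set ?enum_rankK ?mulr1//= enum_rankK.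
  move=> k kx; rewrite scale_indicE memNset ?mulr0//=.
  by move=> lx; move: kx; rewrite lx enum_valK eqxx.
Qed.

Section simple.
Variable R : realType.
Implicit Types f g : X -> R.

Lemma simple_op1 (phi : R -> R) f : is_simple F f -> is_simple F (phi \o f).
Proof.
move=> /is_simpleP[I [lab [c [Flab ->]]]]; apply/is_simpleP.
by exists I, lab, (phi \o c).
Qed.

(** The pair of labels encodes the common refinement of the two partitions. *)
Lemma simple_pair f g : is_simple F f -> is_simple F g ->
  exists (I : finType) (lab : X -> I) (c d : I -> R),
    [/\ flab lab, f = c \o lab & g = d \o lab].
Proof.
move=> /is_simpleP[I [lab [c [Flab ->]]]] /is_simpleP[J [lab' [d [Flab' ->]]]].
exists (I * J)%type, (fun x => (lab x, lab' x)), (c \o fst), (d \o snd).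
by split=> //; exact: flab_pair.
Qed.

Lemma simple_op2 (phi : R -> R -> R) f g : is_simple F f -> is_simple F g ->
  is_simple F (fun x => phi (f x) (g x)).
Proof.
move=> sf sg; have [I [lab [c [d [Flab -> ->]]]]] := simple_pair sf sg.
by apply/is_simpleP; exists I, lab, (fun i => phi (c i) (d i)).
Qed.

Lemma simple_pre f (P : pred R) : is_simple F f -> F [set x | P (f x)].
Proof.
move=> /is_simpleP[I [lab [c [Flab ->]]]].
exact: (flab_pre (preim c P)).
Qed.

Lemma simple_cst (a : R) : is_simple F (fun=> a).
Proof.
apply/is_simpleP; exists unit, (fun=> tt), (fun=> a); split=> // -[].
by rewrite (_ : _ @^-1` _ = setT) ?seteqP//; exact: fsetT.
Qed.

Lemma simple_indic E : F E -> is_simple F (\1_E : X -> R).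
Proof.
move=> FE; apply/is_simpleP; exists bool, (fun x => x \in E),
  (fun b : bool => b%:R).
split=> [[]|]; last by apply/funext => x; rewrite /= indicE.
  rewrite (_ : _ @^-1` _ = E)//.
  by apply/seteqP; split => x /=; [exact: set_mem | exact: mem_set].
rewrite (_ : _ @^-1` _ = ~` E); first exact: fsetC.
apply/seteqP; split => x /=; last exact: memNset.
by move=> + Ex; rewrite mem_set.
Qed.

Lemma simple_if E f g : F E -> is_simple F f -> is_simple F g ->
  is_simple F (fun x => if x \in E then f x else g x).
Proof.
move=> FE sf sg; have sE := simple_indic FE.
have := simple_op2 (fun a b => a + b) (simple_op2 (fun a b => a * b) sE sf)
  (simple_op2 (fun a b => (1 - a) * b) sE sg).
congr is_simple; apply/funext => x; rewrite indicE; case: (x \in E).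
  by rewrite mul1r subrr mul0r addr0.
by rewrite mul0r subr0 mul1r add0r.
Qed.

Lemma simple_bounded f : is_simple F f -> exists2 M : R, 0 <= M & forall x,
  `|f x| <= M.
Proof.
move=> /is_simpleP[I [lab [c [Flab ->]]]].
exists (\sum_i `|c i|); first exact: sumr_ge0.
by move=> x /=; rewrite (bigD1 (lab x))//= lerDl sumr_ge0.
Qed.

End simple.
End FieldOfSets.

Lemma is_simpleS (X : Type) (R : realType) (F G : set (set X)) (f : X -> R) :
  F `<=` G -> is_simple F f -> is_simple G f.
Proof.
move=> FG [K [c [D [FD tD UD ->]]]].
by exists K, c, D; split=> // k; exact/FG/FD.
Qed.

(** * Charges and integrals of simple functions *)

Section Charge.
Variables (X : Type) (R : realType) (A : set (set X)) (mu : set X -> R).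
Hypothesis chA : charge_space A mu.

Let fA : field_of_sets A. Proof. by case: chA. Qed.

Lemma charge_set0 : mu set0 = 0. Proof. by case: chA => _ []. Qed.

Lemma charge_ge0 E : A E -> 0 <= mu E.
Proof. by case: chA => _ [_ + _]; apply. Qed.

Lemma chargeU D E : A D -> A E -> D `&` E = set0 -> mu (D `|` E) = mu D + mu E.
Proof. by case: chA => _ [_ _]; apply. Qed.

Lemma charge_setD D E : A D -> A E -> D `<=` E -> mu (E `\` D) = mu E - mu D.
Proof.
move=> AD AE DE; apply/(addrI (mu D)); rewrite -chargeU//; last 2 first.
- exact: fsetD.
- by rewrite setDE setICA setICr setI0.
by rewrite setDUK// addrC subrK.
Qed.

Lemma charge_le D E : A D -> A E -> D `<=` E -> mu D <= mu E.
Proof.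
move=> AD AE DE; rewrite -subr_ge0 -charge_setD//; apply: charge_ge0;
  exact: fsetD.
Qed.

Lemma chargeU_le D E : A D -> A E -> mu (D `|` E) <= mu D + mu E.
Proof.
move=> AD AE; rewrite (_ : D `|` E = D `|` (E `\` D)).
  rewrite chargeU//; last 2 first.
  - exact: fsetD.
  - by rewrite setDE setICA setICr setI0.
  by rewrite lerD2l; apply: charge_le => //; exact: fsetD.
by apply/seteqP; split=> x /=; case: (pselect (D x)); tauto.
Qed.

Lemma charge_flab (I : finType) (lab : X -> I) E : A E -> flab A lab ->
  mu E = \sum_i mu (E `&` lab @^-1` [set i]).
Proof.
move=> AE Alab.
(* Finite additivity is an induction on a duplicate-free list of labels, splitting off one cell at a
   time. *)
suff S (s : seq I) : uniq s -> mu (E `&` [set x | lab x \in s]) =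
    \sum_(i <- s) mu (E `&` lab @^-1` [set i]).
  rewrite -S ?index_enum_uniq// (_ : E `&` _ = E)//.
  by apply/setIidPl => x _ /=; rewrite mem_index_enum.
elim: s => [_|i s IHs /= /andP[nis us]].
  by rewrite big_nil (_ : _ `&` _ = set0) ?charge_set0//; apply/seteqP;
    split=> x [].
rewrite big_cons -IHs// -chargeU.
- congr mu; apply/seteqP; split => x /=; rewrite inE.
    by move=> [Ex /predU1P[->|]]; [left|right].
  by move=> [[Ex ->]|[Ex ->]]; rewrite ?eqxx ?orbT.
- by apply: fsetI => //; exact: Alab.
- by apply: fsetI => //; exact: flab_mem.
- apply/seteqP; split => x //= [[_ ->] [_]].
  by rewrite (negPf nis).
Qed.

(** Both sums are refined to pairs of labels. A nonempty cell contains a point at which the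
    hypothesis compares the coefficients; an empty cell has charge 0. This gives monotonicity of the
    simple integral and its independence of the representation. *)
Lemma flab_sum_le (I J : finType) (lab : X -> I) (lab' : X -> J)
    (c : I -> R) (d : J -> R) : flab A lab -> flab A lab' ->
  (forall x, c (lab x) <= d (lab' x)) ->
  \sum_i c i * mu (lab @^-1` [set i]) <= \sum_j d j * mu (lab' @^-1` [set j]).
Proof.
move=> Al Al' cd.
under eq_bigr do rewrite (charge_flab (Al _) Al') mulr_sumr.
under [leRHS]eq_bigr do rewrite (charge_flab (Al' _) Al) mulr_sumr.
rewrite [leRHS]exchange_big/=; apply: ler_sum => i _; apply: ler_sum => j _.
rewrite (setIC (lab' @^-1` _)).
have [->|/set0P[x [/= <- <-]]] := eqVneq (lab @^-1` [set i] `&` lab' @^-1` [set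
  j]) set0.
  by rewrite charge_set0 !mulr0.
by apply: ler_wpM2r => //; apply: charge_ge0; exact: fsetI.
Qed.

Definition subfield (F : set (set X)) := field_of_sets F /\ F `<=` A.

Lemma subfieldA : subfield A. Proof. by split. Qed.
#[local] Hint Resolve subfieldA : core.

Lemma simple_integralE F (I : finType) (lab : X -> I) (c : I -> R) :
  subfield F -> flab F lab ->
  simple_integral F mu (c \o lab) = \sum_i c i * mu (lab @^-1` [set i]).
Proof.
move=> [fF FA] Fl; rewrite /simple_integral.
have Al i : A (lab @^-1` [set i]) by apply/FA/Fl.
suff E (K : nat) d (D : 'I_K -> set X) : simple_repr F (c \o lab) d D ->
    \sum_k d k * mu (D k) = \sum_i c i * mu (lab @^-1` [set i]).
  have : is_simple F (c \o lab) by apply/is_simpleP; exists I, lab, c.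
  move=> [K [d [D FD]]]; apply: xget_unique.
    by exists K, d, D; split=> //; rewrite (E _ _ _ FD).
  by move=> _ [K' [d' [D' [FD' ->]]]]; exact: E.
move=> [FD tD UD cE].
have /choice[lab' labP] : forall x, exists k, D k x.
  move=> x; have : [set: X] x by [].
  by rewrite -UD => -[k _ Dk]; exists k.
have labD k x : D k x -> lab' x = k.
  by move=> Dkx; apply: tD => //; exists x; split.
have DE k : D k = lab' @^-1` [set k].
  by apply/seteqP; split => x /= => [/labD|<-].
have cd x : c (lab x) = d (lab' x).
  rewrite -[LHS]/((c \o lab) x) cE fct_sumE (bigD1 (lab' x))//= big1 ?addr0.
    by rewrite scale_indicE (mem_set (labP x)) mulr1.
  move=> k kx; rewrite scale_indicE memNset ?mulr0//= => /labD/eqP.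
  by rewrite eq_sym (negPf kx).
have Al' : flab A lab' by move=> k; rewrite -DE; exact/FA/FD.
under eq_bigr do rewrite DE.
by apply/eqP; rewrite eq_le !flab_sum_le// => x; rewrite cd.
Qed.

Local Notation SI := (simple_integral A mu).

Lemma simple_integral_sub F f : subfield F -> is_simple F f ->
  simple_integral F mu f = SI f.
Proof.
move=> sF; have [fF FA] := sF.
move=> /is_simpleP[I [lab [c [Fl ->]]]]; rewrite !simple_integralE//.
by move=> i; exact/FA/Fl.
Qed.

Lemma simple_integral_lin (a : R) f g : is_simple A f -> is_simple A g ->
  SI (fun x => a * f x + g x) = a * SI f + SI g.
Proof.
move=> sf sg; have [I [lab [c [d [Al -> ->]]]]] := simple_pair fA sf sg.
rewrite (_ : (fun=> _) = (fun i => a * c i + d i) \o lab)// !simple_integralE//.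
rewrite mulr_sumr -big_split/=; apply: eq_bigr => i _.
by rewrite mulrDl mulrA.
Qed.

Lemma simple_integral_le f g : is_simple A f -> is_simple A g ->
  (forall x, f x <= g x) -> SI f <= SI g.
Proof.
move=> /is_simpleP[I [lab [c [Fl ->]]]] /is_simpleP[J [lab' [d [Fl' ->]]]] cd.
by rewrite !simple_integralE//; exact: flab_sum_le.
Qed.

Lemma simple_integral_cst (a : R) : SI (fun=> a) = a * mu setT.
Proof.
rewrite (_ : (fun=> a) = (fun=> a) \o (fun=> tt))// simple_integralE//;
  last first.
  move=> -[]; rewrite (_ : _ @^-1` _ = setT); first exact: fsetT.
  by apply/seteqP; split.
rewrite (bigD1 tt)//= big1 ?addr0; last by case.
by congr (_ * mu _); apply/seteqP; split.
Qed.

Lemma simple_integral_indic E : A E -> SI (\1_E : X -> R) = mu E.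
Proof.
move=> AE; have AnE := fsetC fA AE.
have E1 : (fun x => x \in E) @^-1` [set true] = E.
  by apply/seteqP; split => x /=; [exact: set_mem | exact: mem_set].
have E0 : (fun x => x \in E) @^-1` [set false] = ~` E.
  apply/seteqP; split => x /=; last exact: memNset.
  by move=> + Ex; rewrite mem_set.
rewrite (_ : \1_E = (fun b : bool => b%:R) \o (fun x => x \in E)); last first.
  by apply/funext => x; rewrite /= indicE.
rewrite simple_integralE//; last by case; rewrite ?E1 ?E0.
by rewrite big_bool/= E1 E0 mul1r mul0r addr0.
Qed.

(** The form in which hazy closeness enters integrals: a uniform error [a], and a crude bound [K] on
    an exceptional set [T] whose small charge compensates for it. *)
Lemma simple_integral_bound u v (a K : R) T :
  is_simple A u -> is_simple A v -> A T ->
  (forall x, u x <= v x + a + K * (x \in T)%:R) ->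
  SI u <= SI v + a * mu setT + K * mu T.
Proof.
move=> su sv AT uv.
have sT := simple_indic fA R AT.
have sc := simple_cst fA a.
have s1 := simple_op2 fA (fun x y => K * x + y) sT sc.
have s2 := simple_op2 fA (fun x y => 1 * x + y) sv s1.
apply: (le_trans (simple_integral_le su s2 _)).
  by move=> x; rewrite (le_trans (uv x))// indicE mul1r (addrC (K * _)) addrA.
rewrite (simple_integral_lin _ sv s1) (simple_integral_lin _ sT sc).
by rewrite mul1r simple_integral_indic// simple_integral_cst (addrC (K * _))
  addrA.
Qed.

End Charge.

(** * Outer charge and T1-measurability *)

Section Outer.
Variables (X : Type) (R : realType) (A : set (set X)) (mu : set X -> R).
Hypothesis chA : charge_space A mu.

Let fA : field_of_sets A. Proof. by case: chA. Qed.

Section subfield.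
Variable F : set (set X).
Hypothesis sF : subfield A F.

Let fF : field_of_sets F. Proof. by case: sF. Qed.
Let FA : F `<=` A. Proof. by case: sF. Qed.

Lemma subcharge_ge0 E : F E -> 0 <= mu E.
Proof. by move=> /FA; exact: charge_ge0. Qed.

Lemma outer_has_inf E : has_inf [set mu B | B in [set B | F B /\ E `<=` B]].
Proof.
split; first by exists (mu setT), setT => //; split=> //; exact: fsetT.
by exists 0 => _ [B [FB _] <-]; exact: subcharge_ge0.
Qed.

Lemma outer_charge_le E B : F B -> E `<=` B -> outer_charge F mu E <= mu B.
Proof.
by move=> FB EB; apply: ge_inf; [case: (outer_has_inf E)|exists B].
Qed.

Lemma outer_charge_ltP E e : outer_charge F mu E < e <->
  exists B, [/\ F B, E `<=` B & mu B < e].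
Proof.
split=> [Ee|[B [FB EB Be]]]; last exact: le_lt_trans (outer_charge_le FB EB) Be.
have e0 : 0 < e - outer_charge F mu E by rewrite subr_gt0.
have [_ [B [FB EB] <-]] := inf_adherent e0 (outer_has_inf E).
by rewrite addrC subrK => Be; exists B.
Qed.

Lemma outer_charge_ge E a :
  (forall B, F B -> E `<=` B -> a <= mu B) -> a <= outer_charge F mu E.
Proof.
move=> aB; apply: lb_le_inf; first by case: (outer_has_inf E).
by move=> _ [B [FB EB] <-]; exact: aB.
Qed.

Lemma outer_charge_ge0 E : 0 <= outer_charge F mu E.
Proof. by apply: outer_charge_ge => B FB _; exact: subcharge_ge0. Qed.

Lemma outer_chargeS D E : D `<=` E -> outer_charge F mu D <= outer_charge F mu
  E.
Proof.
move=> DE; apply: outer_charge_ge => B FB EB.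
by apply: outer_charge_le => //; exact: subset_trans EB.
Qed.

(** The exceptional set is covered by a member of [F], and one tolerance bounds both its charge and
    the error; conversely, two separate tolerances are met by their minimum. *)
Lemma hazy_cvgP (u : nat -> X -> R) (f : X -> R) : hazy_cvg F mu u f <->
  forall e : R, 0 < e -> exists N, forall n, (N <= n)%N ->
    exists T, [/\ F T, mu T < e & forall x, ~ T x -> `|u n x - f x| <= e].
Proof.
split=> [uf e e0|uf e e0].
  have /cvgrPdist_lt/(_ e e0)[N _ Ne] := uf e e0.
  exists N => n Nn; have := Ne n Nn; rewrite /= sub0r normrN.
  rewrite ger0_norm ?outer_charge_ge0// => /outer_charge_ltP[T [FT fT Te]].
  by exists T; split=> // x Tx; rewrite leNgt; apply/negP => /fT.
apply/cvgrPdist_lt => d d0.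
have ed0 : 0 < Order.min e d by rewrite lt_min e0.
have [N Ne] := uf _ ed0; exists N => // n /Ne[T [FT Te fT]]/=.
rewrite sub0r normrN ger0_norm ?outer_charge_ge0//; apply/outer_charge_ltP.
exists T; split=> //; last by move: Te; rewrite lt_min => /andP[].
move=> x /=; apply: contraPP => /fT; rewrite le_min => /andP[+ _].
by rewrite leNgt => /negP.
Qed.

Definition ae_close (f s : X -> R) (e : R) T :=
  [/\ F T, mu T < e & forall x, ~ T x -> `|f x - s x| <= e].

(** Measurability can thus be treated one tolerance at a time; tolerances [1 / (n + 1)] recover a
    sequence. *)
Lemma T1_measurableP f : T1_measurable F mu f <->
  forall e, 0 < e -> exists s T, is_simple F s /\ ae_close f s e T.
Proof.
split=> [[u [su /hazy_cvgP uf]] e e0|fe].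
  have [N /(_ N (leqnn N))[T [FT Te uT]]] := uf e e0.
  by exists (u N), T; split=> //; split=> // x Tx; rewrite distrC uT.
have /choice[u uP] : forall n : nat, exists s, is_simple F s /\
    exists T, ae_close f s n.+1%:R^-1 T.
  move=> n; have [|s [T [ss sT]]] := fe n.+1%:R^-1; first by rewrite invr_gt0.
  by exists s; split=> //; exists T.
exists u; split=> [n|]; first by case: (uP n).
apply/hazy_cvgP => e e0; exists (Num.truncn e^-1) => n en.
have [_ [T [FT Te fT]]] := uP n.
have ne : n.+1%:R^-1 <= e.
  rewrite -[leRHS]invrK lef_pV2 ?posrE ?invr_gt0//.
  by rewrite (le_trans (ltW (truncnS_gt _)))// ler_nat.
exists T; split=> //; first exact: lt_le_trans Te _.
by move=> x Tx; rewrite distrC (le_trans (fT x Tx)).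
Qed.

Lemma simple_T1 s : is_simple F s -> T1_measurable F mu s.
Proof.
move=> ss; apply/T1_measurableP => e e0; exists s, set0; split=> //.
split; [exact: fset0|by rewrite (charge_set0 chA)|].
by move=> x _; rewrite subrr normr0 ltW.
Qed.

End subfield.

Lemma T1_sub F G f : subfield A F -> subfield A G -> F `<=` G ->
  T1_measurable F mu f -> T1_measurable G mu f.
Proof.
move=> sF sG FG /(T1_measurableP sF) fe; apply/(T1_measurableP sG) => e e0.
have [s [T [ss [FT Te fT]]]] := fe e e0.
by exists s, T; split; [exact: is_simpleS ss|split=> //; exact: FG].
Qed.

End Outer.

(** The sets in the sum are replaced one by one, halving the tolerance each time; [Q] records the
    size of the accumulated exceptional set. It is instantiated with small charge for completions,
    and with nullity for null sets. *)
Lemma simple_transfer (X : Type) (R : realType) (G H : set (set X))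
    (Q : R -> set X -> Prop) :
  field_of_sets G -> field_of_sets H ->
  (forall d e D E, Q d D -> Q e E -> Q (d + e) (D `|` E)) ->
  (forall e E, 0 < e -> G E ->
     exists E' Z, [/\ H E', Q e Z & forall x, ~ Z x -> E x <-> E' x]) ->
  forall (s : X -> R) e, 0 < e -> is_simple G s ->
    exists s' Z, [/\ is_simple H s', Q e Z & forall x, ~ Z x -> s x = s' x].
Proof.
move=> fG fH QU GH s e e0 [K [c [D [GD _ _ ->]]]].
elim: K c D GD e e0 => [|K IHK] c D GD e e0.
  (* An empty sum still requires some [Z] with [Q e Z]; transferring the empty set supplies it. *)
  have [E [Z [_ QZ _]]] := GH e set0 e0 (fset0 fG).
  exists (fun=> 0), Z; split=> //; first exact: simple_cst.
  by move=> x _; rewrite big_ord0.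
have e20 : 0 < e / 2 by rewrite divr_gt0.
have [t [Z [st QZ tZ]]] := IHK (c \o lift ord0) (D \o lift ord0)
  (fun k => GD (lift ord0 k)) _ e20.
have [E [Y [HE QY EY]]] := GH _ _ e20 (GD ord0).
exists (fun x => c ord0 * \1_E x + t x), (Y `|` Z); split.
- exact: (simple_op2 fH (fun a b => c ord0 * a + b) (simple_indic fH R HE) st).
- by rewrite (splitr e); exact: QU.
- move=> x /not_orP[Yx Zx]; rewrite big_ord_recl.
  rewrite -(tZ x Zx) -[LHS]/(_ x + _ x) scale_indicE indicE.
  suff -> : (x \in D ord0) = (x \in E) by [].
  by apply/idP/idP; rewrite !inE => /(EY x Yx).
Qed.

(** * Facts about the real line *)

Section RealLemmas.
Variable R : realType.

Lemma half_pow_gt0 n : 0 < (2^-1 : R) ^+ n.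
Proof. by rewrite exprn_gt0// invr_gt0. Qed.

Lemma half_pow_lt (e : R) : 0 < e -> exists n, (2^-1 : R) ^+ n < e.
Proof.
move=> e0; exists (Num.truncn e^-1).+1.
rewrite exprVn -[ltRHS]invrK ltf_pV2 ?posrE ?exprn_gt0 ?invr_gt0//.
apply: (lt_trans (truncnS_gt _)); rewrite -natrX ltr_nat.
exact: ltn_expl.
Qed.

(** The supremum of the lower ends lies in all intervals selected by [P]; if [P] selects none, any
    point will do. It serves as the limit both of the bisection and, pointwise, of clipped
    sequences. *)
Lemma cut_point (P : nat -> Prop) (a b : nat -> R) :
  (forall n m, P n -> P m -> a n <= b m) ->
  exists y, forall n, P n -> a n <= y /\ y <= b n.
Proof.
move=> ab; have [[n0 Pn0]|noP] := pselect (exists n, P n); last first.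
  by exists 0 => n Pn; exfalso; apply: noP; exists n.
have ub m : P m -> ubound [set a n | n in P] (b m).
  by move=> Pm _ [n Pn <-]; exact: ab.
exists (sup [set a n | n in P]) => n Pn; split.
  by apply: ub_le_sup; [exists (b n0); exact: ub|exists n].
by apply: ge_sup; [exists (a n), n|exact: ub].
Qed.

(* Only existence of one point of continuity is needed, so repeated bisection
   keeping the half with the smaller drop suffices. *)
Lemma nonincreasing_continuity_point (F : R -> R) a b : a < b ->
  (forall x y, x <= y -> F y <= F x) ->
  exists t, [/\ a < t, t < b &
    forall d, 0 < d -> exists2 h, 0 < h & F (t - h) - F (t + h) <= d].
Proof.
move=> ab ndF.
have /choice[f fP] : forall p : R * R, exists q : R * R, p.1 < p.2 ->
    [/\ p.1 < q.1, q.1 < q.2, q.2 < p.2 & F q.1 - F q.2 <= (F p.1 - F p.2) / 2].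
  move=> [c d] /=; have [cd|] := pselect (c < d); last by exists (c, d).
  (* The half with at most half the drop is shrunk to an interval in its interior, so that the
     common point lies strictly inside every interval and has room on both sides. *)
  have [h|h] := leP (F c - F ((c + d) / 2)) ((F c - F d) / 2).
    exists (c + (d - c) / 6, c + (d - c) / 3) => _ /=; split; [lra|lra|lra|].
    have := ndF c (c + (d - c) / 6) ltac:(lra).
    have := ndF (c + (d - c) / 3) ((c + d) / 2) ltac:(lra).
    lra.
  exists (d - (d - c) / 3, d - (d - c) / 6) => _ /=; split; [lra|lra|lra|].
  have := ndF (d - (d - c) / 6) d ltac:(lra).
  have := ndF ((c + d) / 2) (d - (d - c) / 3) ltac:(lra).
  lra.
pose u n := iter n f (a, b).
have uS n : u n.+1 = f (u n) by [].
have u12 n : (u n).1 < (u n).2.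
  by elim: n => // n IHn; rewrite uS; case: (fP _ IHn).
have u1 n m : (n <= m)%N -> (u n).1 <= (u m).1.
  move: n m; apply: (@homo_leq _ (fun k => (u k).1) <=%R) => [x|y x z|k] //.
    exact: le_trans.
  by rewrite uS; case: (fP _ (u12 k)) => /ltW.
have u2 n m : (n <= m)%N -> (u m).2 <= (u n).2.
  rewrite -lerN2; move: n m.
  apply: (@homo_leq _ (fun k => - (u k).2) <=%R) => [x|y x z|k] //.
    exact: le_trans.
  by rewrite lerN2 uS; case: (fP _ (u12 k)) => _ _ /ltW.
have [t ut] : exists y, forall n, True -> (u n).1 <= y /\ y <= (u n).2.
  apply: (@cut_point (fun=> True) (fun n => (u n).1) (fun n => (u n).2)) => n m
    _ _.
  have := u1 _ _ (leq_maxl n m); have := u2 _ _ (leq_maxr n m).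
  have := u12 (maxn n m); lra.
have ut1 n : (u n).1 < t /\ t < (u n).2.
  have [] := ut n.+1 I; rewrite uS; case: (fP _ (u12 n)); lra.
exists t; split; [by case: (ut1 0%N)|by case: (ut1 0%N)|move=> d d0].
have Fu n : F (u n).1 - F (u n).2 <= (F a - F b) * (2^-1) ^+ n.
  elim: n => [|n IHn]; first by rewrite expr0 mulr1.
  rewrite exprSr mulrA uS; case: (fP _ (u12 n)) => _ _ _; lra.
have D0 : 0 <= F a - F b by rewrite subr_ge0 ndF// ltW.
(* The added [1] keeps the denominator positive when [F a = F b]. *)
have [|n nd] := @half_pow_lt (d / (F a - F b + 1));
  first by rewrite divr_gt0//; lra.
have {}nd : (F a - F b) * (2^-1) ^+ n <= d.
  move: nd; rewrite ltr_pdivlMr; last lra.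
  by have := half_pow_gt0 n; nra.
have [tn1 tn2] := ut1 n.
exists (Order.min (t - (u n).1) ((u n).2 - t));
  first by rewrite lt_min !subr_gt0 tn1.
apply: le_trans nd; apply: le_trans (Fu n); apply: lerB; apply: ndF.
  by rewrite lerBrDr addrC -lerBrDr ge_min lexx.
by rewrite addrC -lerBrDr ge_min lexx orbT.
Qed.

(** T1-measurable functions are bounded off sets of small charge, so Lipschitz bounds on bounded
    sets are what composition calls for. *)
Definition locally_lipschitz (phi : R -> R) := forall K : R, exists2 C : R,
  0 < C &
  forall x y : R, `|x| <= K -> `|y| <= K -> `|phi x - phi y| <= C * `|x - y|.

(** A substitute for the mean value theorem: with [q = y / x] and an integer [m >= p],
    [1 - q ^ p <= 1 - q ^ m <= m (1 - q)]; the factor [x ^ p] is then at most [K ^ (p - 1)] times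
    [x]. *)
Lemma powR_sub_le (p K x y : R) : 1 <= p -> 0 <= y <= x -> x <= K -> 
  x `^ p - y `^ p <= (Num.truncn p).+1%:R * K `^ (p - 1) * (x - y).
Proof.
move=> p1 /andP[y0 yx] xK; have [->|xN0] := eqVneq x y.
  by rewrite !subrr mulr0.
have x0 : 0 < x by lra.
have K0 : 0 < K by lra.
set m := (Num.truncn p).+1.
have q01 : 0 <= y / x <= 1 by rewrite divr_ge0 ?ler_pdivrMr ?mul1r//; lra.
have yE : y `^ p = x `^ p * (y / x) `^ p.
  by rewrite -powRM; [rewrite mulrCA divff ?mulr1//|lra|lra]; lra.
have qm : (y / x) ^+ m <= (y / x) `^ p.
  have [->|q0] := eqVneq (y / x) 0; first by rewrite expr0n/= powR_ge0.
  have q1 : 0 < y / x by lra.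
  rewrite -powR_mulrn; last lra.
  by apply: ger_powR; [lra|exact/ltW/truncnS_gt].
(* Bernoulli's inequality with the integer exponent m >= p. *)
have bern : 1 - (y / x) ^+ m <= m%:R * (1 - y / x).
  move: (y / x) q01 => q q01; elim: m {qm} => [|m IHm];
    first by rewrite expr0 mul0r subrr.
  rewrite exprS -natr1 mulrDl mul1r.
  have : 0 <= q ^+ m <= 1 by rewrite exprn_ge0 ?exprn_ile1//; lra.
  nra.
have xp0 : 0 <= x `^ p by exact: powR_ge0.
have -> : x - y = x * (1 - y / x) by rewrite mulrBr mulr1 mulrCA divff
  ?mulr1//; lra.
have xp : x `^ p <= K `^ (p - 1) * x.
  rewrite -(@mulr_powRB1 _ x p) ?(ltW x0)//; last lra.
  rewrite mulrC ler_wpM2r ?(ltW x0)// ge0_ler_powR ?nnegrE//; lra.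
rewrite yE; apply: (@le_trans _ _ (x `^ p * (m%:R * (1 - y / x)))).
  rewrite -[X in X - _]mulr1 -mulrBr ler_wpM2l//; lra.
rewrite mulrCA -mulrA ler_wpM2l// mulrA ler_wpM2r//; lra.
Qed.

Lemma locally_lipschitz_powR (p : R) : 1 <= p ->
  locally_lipschitz (fun x => `|x| `^ p).
Proof.
(* [|K| + 1] in place of [K] keeps the constant positive whatever the sign of [K]. *)
move=> p1 K; exists ((Num.truncn p).+1%:R * (`|K| + 1) `^ (p - 1)).
  by rewrite mulr_gt0// powR_gt0// ltr_pwDr.
suff H : forall x y : R, `|y| <= `|x| -> `|x| <= K ->
    `| `|x| `^ p - `|y| `^ p| <= (Num.truncn p).+1%:R * (`|K| + 1) `^ (p - 1) *
      `|x - y|.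
  move=> x y xK yK; have [|/ltW] := leP `|y| `|x|; first by move=> yx; exact: H.
  by rewrite distrC (distrC x) => xy; exact: H.
move=> x y yx xK; rewrite ger0_norm; last first.
  by rewrite subr_ge0 ge0_ler_powR ?nnegrE//; lra.
apply: (le_trans (@powR_sub_le p (`|K| + 1) `|x| `|y| p1 _ _)).
- by rewrite normr_ge0.
- by have := ler_norm K; lra.
- by rewrite ler_wpM2l ?lerB_normD ?lerB_dist// mulr_ge0// powR_ge0.
Qed.

End RealLemmas.

(** * Completions, null sets and level sets *)

Section Completion.
Variables (X : Type) (R : realType) (A : set (set X)) (mu : set X -> R).
Hypotheses (chA : charge_space A mu) (hPJ : PJ_complete A mu).

Let fA : field_of_sets A. Proof. by case: chA. Qed.
Let sA : subfield A A. Proof. exact: subfieldA chA. Qed.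
Local Notation N := (null_sets A mu).

(** A null set is squeezed between the empty set and covers of small charge, so completeness puts it
    in [A]. *)
Lemma null_setsP E : N E <-> A E /\ mu E = 0.
Proof.
split=> [NE|[AE E0]]; last first.
  apply/eqP; rewrite eq_le (outer_charge_ge0 chA sA) andbT -E0.
  exact: (outer_charge_le chA sA).
have AE : A E.
  rewrite -hPJ => e e0.
  have /(outer_charge_ltP chA sA)[B [AB EB Be]] : outer_charge A mu E < e.
    by rewrite (_ : outer_charge _ _ _ = 0).
  exists set0, B; split=> //; first exact: fset0.
  by rewrite setD0.
split=> //; apply/eqP; rewrite eq_le (charge_ge0 chA AE) andbT -NE.
by apply: (outer_charge_ge chA sA) => B AB EB; exact: (charge_le chA).
Qed.

Lemma null_small E : (forall e, 0 < e -> exists B, [/\ A B,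
  E `<=` B & mu B < e]) -> N E.
Proof.
move=> Ee; apply/eqP; rewrite eq_le (outer_charge_ge0 chA sA) andbT.
apply/ler_addgt0Pl => e e0; rewrite addr0; apply/ltW.
by apply/(outer_charge_ltP chA sA); exact: Ee.
Qed.

Lemma null_set0 : N set0.
Proof. by apply/null_setsP; split; [exact: fset0|exact: charge_set0 chA]. Qed.

Lemma null_setS D E : D `<=` E -> N E -> N D.
Proof.
move=> DE /null_setsP[AE E0]; apply: null_small => e e0.
by exists E; rewrite E0.
Qed.

Lemma null_setU D E : N D -> N E -> N (D `|` E).
Proof.
move=> /null_setsP[AD D0] /null_setsP[AE E0]; apply: null_small => e e0.
exists (D `|` E); split=> //; first exact: fsetU.
by rewrite (le_lt_trans (chargeU_le chA AD AE))// D0 E0 addr0.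
Qed.

Section PJ.
Variable F : set (set X).
Hypothesis sF : subfield A F.
Let fF : field_of_sets F. Proof. by case: sF. Qed.
Let FA : F `<=` A. Proof. by case: sF. Qed.

Lemma sub_PJ_completion : F `<=` PJ_completion F mu.
Proof.
move=> E FE e e0; exists E, E; split=> //.
by rewrite setDv (charge_set0 chA).
Qed.

Lemma PJ_completion_sub G : F `<=` G -> PJ_completion F mu `<=` PJ_completion G
  mu.
Proof.
move=> FG E FE e /FE[B [C [FB FC BE EC BC]]].
by exists B, C; split=> //; exact: FG.
Qed.

Lemma PJ_subfield : subfield A (PJ_completion F mu).
Proof.
split; last by rewrite -[X in _ `<=` X]hPJ; exact: PJ_completion_sub.
split.
- apply: sub_PJ_completion; exact: fset0.
- move=> E FE e /FE[B [C [FB FC BE EC BC]]]; exists (~` C), (~` B); split.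
  + exact: fsetC.
  + exact: fsetC.
  + exact: subsetC.
  + exact: subsetC.
  + by rewrite setDE setCK setIC -setDE.
- move=> D E FD FE e e0; have e20 : 0 < e / 2 by rewrite divr_gt0.
  have [B [C [FB FC BD DC BC]]] := FD _ e20.
  have [B' [C' [FB' FC' BE EC BC']]] := FE _ e20.
  exists (B `|` B'), (C `|` C'); split; [exact: fsetU|exact: fsetU|exact:
    setUSS|exact: setUSS|].
  have FCB : F (C `\` B) by exact: fsetD.
  have FCB' : F (C' `\` B') by exact: fsetD.
  rewrite (splitr e); apply: le_lt_trans (ltrD BC BC').
  apply: le_trans (chargeU_le chA (FA FCB) (FA FCB')).
  apply: (charge_le chA).
  + apply: FA; apply: fsetD => //; exact: fsetU.
  + apply: FA; exact: fsetU.
  + by move=> x [[Cx|Cx] /not_orP[Bx Bx']]; [left|right].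
Qed.

(** Each set of the completion is replaced by an inner approximation, at the cost of a gap of small
    charge that joins the exceptional set. *)
Lemma T1_PJ (f : X -> R) : T1_measurable (PJ_completion F mu) mu f ->
  T1_measurable F mu f.
Proof.
move=> /(T1_measurableP chA PJ_subfield) fe.
apply/(T1_measurableP chA sF) => e e0.
have e20 : 0 < e / 2 by rewrite divr_gt0.
have [s [T [ss [PT Te fT]]]] := fe _ e20.
have e40 : 0 < e / 2 - mu T by rewrite subr_gt0.
have [B [C [FB FC BT TC BC]]] := PT _ e40.
pose Q d Z := F Z /\ mu Z < d.
have [||s' [Z [ss' [FZ Ze] sZ]]] := simple_transfer (Q := Q) PJ_subfield.1 fF _
  _ e20 ss.
- move=> d d' D E [FD Dd] [FE Ed]; split; first exact: fsetU.
  by rewrite (le_lt_trans (chargeU_le chA (FA FD) (FA FE)))// ltrD.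
- move=> d E d0 /(_ d d0)[B' [C' [FB' FC' BE EC BC']]].
  exists B', (C' `\` B'); split=> //; first by split=> //; exact: fsetD.
  move=> x nx; split=> [Ex|/BE//]; apply: contrapT => nB; apply: nx; split=> //.
  exact: EC.
have FZC : F (Z `|` C) by exact: fsetU.
exists s', (Z `|` C); split=> //; split=> //.
  apply: (le_lt_trans (chargeU_le chA (FA FZ) (FA FC))).
  have -> : C = T `|` (C `\` T) by rewrite setDUK.
  have PTA := PJ_subfield.2 _ PT.
  have ACT : A (C `\` T) by apply: fsetD => //; exact: FA.
  have := chargeU_le chA PTA ACT.
  have : mu (C `\` T) <= mu (C `\` B).
    apply: (charge_le chA) => //; first by apply: FA; exact: fsetD.
    exact: setDS.
  lra.
move=> x /not_orP[Zx Cx]; rewrite -sZ//.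
by apply: (le_trans (fT x _)); [move=> /TC|lra].
Qed.

(** Take [t] to be a continuity point of the nonincreasing map sending [t] to the outer charge of
    [{f > t}]. For a simple [s] close to [f] off [T], the level set lies between [{s > t + d}] minus
    [T] and [{s > t - d}] plus [T], whose charges differ by little more than the drop of that map
    between [t - h] and [t + h]. *)
Lemma T1_level (f : X -> R) a b : T1_measurable F mu f -> a < b ->
  exists t, [/\ a < t, t < b & PJ_completion F mu [set x | t < f x]].
Proof.
move=> /(T1_measurableP chA sF) fe ab.
have [|t [at_ tb tc]] := @nonincreasing_continuity_point _
    (fun t => outer_charge F mu [set x | t < f x]) a b ab.
  move=> x y xy; apply: (outer_chargeS chA sF) => z /=; exact: le_lt_trans.
exists t; split=> // e e0.
have [|h h0 Fh] := tc (e / 4); first by rewrite divr_gt0.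
(* [h / 2] absorbs two errors [d], one in the level and one in the approximation; [e / 8] pays for
   the two occurrences of [mu T]. *)
pose d := Order.min (h / 2) (e / 8).
have d0 : 0 < d by rewrite lt_min !divr_gt0.
have dh : d <= h / 2 by rewrite ge_min lexx.
have de : d <= e / 8 by rewrite ge_min lexx orbT.
have [s [T [ss [FT Td fT]]]] := fe _ d0.
have Fs r : F [set x | r < s x] by exact: (simple_pre fF (fun y => r < y) ss).
set B0 := [set x | t + d < s x] `\` T.
set D1 := [set x | t - d < s x] `\` T.
have FB0 : F B0 by exact: fsetD.
have FD1 : F D1 by exact: fsetD.
have close x : ~ T x -> s x - d <= f x /\ f x <= s x + d.
  by move=> /fT; rewrite ler_norml => /andP[]; lra.
exists B0, ([set x | t - d < s x] `|` T); split => //.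
- exact: fsetU.
- by move=> x [/= tx /close]; lra.
- move=> x /= tx; have [|/close[]] := pselect (T x); [by right|left => /=; lra].
have BD : B0 `<=` D1 by move=> x [/= tx Tx]; split => //=; lra.
have FDB : F (D1 `\` B0) by exact: fsetD.
have le1 : mu D1 <= outer_charge F mu [set x | t - h < f x].
  apply: (outer_charge_ge chA sF) => B FB hB; apply: (charge_le chA);
    [exact: FA|exact: FA|].
  by apply: subset_trans hB => x [/= tx /close]; lra.
have le2 : outer_charge F mu [set x | t + h < f x] <= mu B0 + mu T.
  apply: le_trans (chargeU_le chA (FA FB0) (FA FT)).
  apply: (outer_charge_le chA sF); first exact: fsetU.
  move=> x /= tx; have [|Tx] := pselect (T x); [by right|left; split=> //=].
  by have := close x Tx; lra.
have DB := charge_setD chA (FA FB0) (FA FD1) BD.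
have : mu (([set x | t - d < s x] `|` T) `\` B0) <= mu (D1 `\` B0) + mu T.
  apply: le_trans (chargeU_le chA (FA FDB) (FA FT)).
  apply: (charge_le chA).
  - apply: FA; apply: fsetD => //; exact: fsetU.
  - apply: FA; exact: fsetU.
  - move=> x [+ Bx]; have [|Tx] := pselect (T x); first by right.
    by move=> [tx|//]; left.
by lra.
Qed.

(** Every level of an indicator strictly between 0 and 1 cuts out the set itself. *)
Lemma T1_indic E : T1_measurable F mu (\1_E : X -> R) -> PJ_completion F mu E.
Proof.
move=> /T1_level/(_ (ltr01 : (0 : R) < 1))[t [t0 t1]].
congr (PJ_completion F mu _); apply/seteqP; split=> x /=; rewrite indicE.
  by have [/set_mem//|_ /= ?] := boolP (x \in E); exfalso; lra.
by move=> /mem_set->.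
Qed.

Lemma indic_T1 E : PJ_completion F mu E -> T1_measurable F mu (\1_E : X -> R).
Proof.
move=> FE; apply: T1_PJ; apply: (simple_T1 chA PJ_subfield).
exact: (simple_indic PJ_subfield.1).
Qed.

End PJ.
End Completion.

(** * Null functions *)

Section NullFunctions.
Variables (X : Type) (R : realType) (A : set (set X)) (mu : set X -> R).
Hypotheses (chA : charge_space A mu) (hPJ : PJ_complete A mu).

Let fA : field_of_sets A. Proof. by case: chA. Qed.
Let sA : subfield A A. Proof. exact: subfieldA chA. Qed.
Local Notation N := (null_sets A mu).

(** * Operations on T1-measurable functions *)

Section T1.
Variable F : set (set X).
Hypothesis sF : subfield A F.
Let fF : field_of_sets F. Proof. by case: sF. Qed.
Let FA : F `<=` A. Proof. by case: sF. Qed.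

Lemma T1_bounded (f : X -> R) (e : R) : T1_measurable F mu f -> 0 < e ->
  exists (K : R) T, [/\ 0 <= K, F T, mu T < e & forall x, ~ T x -> `|f x| <= K].
Proof.
move=> /(T1_measurableP chA sF) fe e0; have [s [T [ss [FT Te fT]]]] := fe e e0.
have [K K0 sK] := simple_bounded ss.
exists (K + e), T; split => //; first by rewrite addr_ge0// ltW.
move=> x Tx; rewrite -(subrK (s x) (f x)) (le_trans (ler_normD _ _))// addrC
  lerD//.
exact: fT.
Qed.

(** Off a set of small charge [f] is bounded by [K] and its approximation by [K + 1], so a single
    Lipschitz constant serves. *)
Lemma T1_comp (phi : R -> R) (f : X -> R) : locally_lipschitz phi ->
  T1_measurable F mu f -> T1_measurable F mu (phi \o f).
Proof.
move=> Lphi mf; apply/(T1_measurableP chA sF) => e e0.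
have e20 : 0 < e / 2 by rewrite divr_gt0.
have [K [T [K0 FT Te fK]]] := T1_bounded mf e20.
have [C C0 phiC] := Lphi (K + 1).
(* [e / 2] is for the charge, [1] keeps [s] within [K + 1], and [e / C] is for the Lipschitz
   bound. *)
pose d := Order.min (e / 2) (Order.min 1 (e / C)).
have d0 : 0 < d by rewrite !lt_min e20 ltr01 divr_gt0.
have de : d <= e / 2 by rewrite ge_min lexx.
have d1 : d <= 1 by rewrite !ge_min lexx !orbT.
have dC : d <= e / C by rewrite !ge_min lexx !orbT.
have [s [S [ss [FS Sd fS]]]] := (T1_measurableP chA sF f).1 mf d d0.
exists (phi \o s), (S `|` T); split; first exact: simple_op1.
split; first exact: fsetU.
  by have := chargeU_le chA (FA FS) (FA FT); lra.
move=> x /not_orP[/fS fs /fK fk] /=.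
have sk : `|s x| <= K + 1.
  rewrite -(subrK (f x) (s x)) (le_trans (ler_normD _ _))// addrC lerD//.
  by rewrite distrC; lra.
apply: (le_trans (phiC _ _ _ sk)); first lra.
by rewrite mulrC -ler_pdivlMr//; lra.
Qed.

Lemma T1_lin (a : R) (f g : X -> R) : T1_measurable F mu f ->
  T1_measurable F mu g -> T1_measurable F mu (a *: f + g).
Proof.
move=> /(T1_measurableP chA sF) fe /(T1_measurableP chA sF) ge_.
apply/(T1_measurableP chA sF) => e e0.
pose d := e / 2 / (`|a| + 1).
have a0 : 0 < `|a| + 1 by rewrite ltr_pwDr.
have d0 : 0 < d by rewrite !divr_gt0.
have dE : d * (`|a| + 1) = e / 2 by rewrite divfK// gt_eqF.
have := normr_ge0 a => na.
have [s [S [ss [FS Sd fS]]]] := fe d d0.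
have [t [T [st [FT Td gT]]]] := ge_ d d0.
exists (fun x => a * s x + t x), (S `|` T); split.
  exact: (simple_op2 fF (fun x y => a * x + y)).
split; first exact: fsetU.
  by have := chargeU_le chA (FA FS) (FA FT); nra.
move=> x /not_orP[/fS fs /gT gt].
rewrite -[(_ + _) x]/(a * f x + g x) opprD addrACA -mulrBr.
rewrite (le_trans (ler_normD _ _))// normrM.
by nra.
Qed.

(** Lowering an approximation by its error, truncating it at 0 and cutting it to 0 on the
    exceptional set puts it below [h] everywhere. *)
Lemma T1_le_approx (h : X -> R) (e : R) : (forall x, 0 <= h x) ->
  T1_measurable F mu h -> 0 < e ->
  exists r T, [/\ is_simple F r, forall x,
    0 <= r x <= h x & ae_close mu F h r e T].
Proof.
move=> h0 /(T1_measurableP chA sF) he e0.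
have e20 : 0 < e / 2 by rewrite divr_gt0.
have [s [T [ss [FT Te hs]]]] := he _ e20.
exists (fun x => (1 - \1_T x) * Order.max (s x - e / 2) 0), T; split.
- by apply: (simple_op2 fF (fun a b => (1 - a) * Order.max (b - e / 2) 0)) =>
    //; exact: simple_indic.
- move=> x; rewrite indicE; have [Tx|Tx] := pselect (T x).
    by rewrite (mem_set Tx) subrr mul0r lexx h0.
  rewrite (memNset Tx) subr0 mul1r le_max lexx orbT/= ge_max h0 andbT.
  by have := hs x Tx; rewrite ler_norml => /andP[]; lra.
- split=> //; first lra.
  move=> x Tx; rewrite indicE (memNset Tx) subr0 mul1r.
  have := hs x Tx; have := h0 x; rewrite !ler_norml => hx /andP[h1 h2].
  by have [|] := leP (s x - e / 2) 0; lra.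
Qed.

End T1.

(** Under finite additivity a countable union of null sets need not be null, so nullity is imposed
    on each level and not on the support. *)
Definition null_fun (h : X -> R) := forall e : R, 0 < e ->
  N [set x | e < `|h x|].

(** The order with respect to which integrals over different subfields are monotone. *)
Definition null_le (h k : X -> R) := forall e : R, 0 < e ->
  N [set x | k x + e < h x].

Lemma null_le_pw h k : (forall x, h x <= k x) -> null_le h k.
Proof.
move=> hk e e0; rewrite (_ : [set _ | _] = set0); first exact: (null_set0 chA).
by apply/seteqP; split=> x //=; have := hk x; lra.
Qed.

Lemma null_le_trans k h l : null_le h k -> null_le k l -> null_le h l.
Proof.
move=> hk kl e e0; have e20 : 0 < e / 2 by rewrite divr_gt0.
apply: (null_setS chA hPJ) (null_setU chA hPJ (hk _ e20) (kl _ e20)) => x /= hx.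
by have [|] := ltP (k x + e / 2) (h x); [left|right => /=; lra].
Qed.

Lemma null_fun_le h k : null_fun (h - k) -> null_le h k.
Proof.
move=> hk e e0; apply: (null_setS chA hPJ) (hk e e0) => x /= hx.
by rewrite -[(_ - _) x]/(h x - k x) ltr_normr; apply/orP; left; lra.
Qed.

Lemma null_fun0 : null_fun 0.
Proof.
move=> e e0; rewrite (_ : [set _ | _] = set0); first exact: (null_set0 chA).
by apply/seteqP; split=> x //=; rewrite -[(0 : X -> R) x]/(0 : R) normr0; lra.
Qed.

Lemma null_fun_lin (a : R) h k : null_fun h -> null_fun k ->
  null_fun (a *: h + k).
Proof.
move=> h0 k0 e e0; pose d := e / 2 / (`|a| + 1).
have a0 : 0 < `|a| + 1 by rewrite ltr_pwDr.
have d0 : 0 < d by rewrite !divr_gt0.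
have dE : d * (`|a| + 1) = e / 2 by rewrite divfK// gt_eqF.
have e20 : 0 < e / 2 by rewrite divr_gt0.
apply: (null_setS chA hPJ) (null_setU chA hPJ (h0 _ d0) (k0 _ e20)) => x /=.
rewrite -[(_ + _) x]/(a * h x + k x) => hx.
have := ler_normD (a * h x) (k x); rewrite normrM => hx'.
have := normr_ge0 a; have := normr_ge0 (h x) => nh na.
have [|hd] := ltP d `|h x|; first by left.
by right => /=; nra.
Qed.

Lemma null_funN h : null_fun h -> null_fun (- h).
Proof.
by move=> /(null_fun_lin (-1))/(_ null_fun0); rewrite scaleN1r addr0.
Qed.

Lemma null_funC h k : null_fun (h - k) -> null_fun (k - h).
Proof. by move=> /null_funN; rewrite opprB. Qed.

(** The function [h] is bounded only off sets of small positive charge, so the level set is shown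
    null by covers of charge below every [d]. *)
Lemma null_fun_comp (phi : R -> R) h k : locally_lipschitz phi ->
  T1_measurable A mu h -> null_fun (h - k) ->
    null_fun ((phi \o h) - (phi \o k)).
Proof.
move=> Lphi mh hk e e0; apply: (null_small chA) => d d0.
have [K [T [K0 AT Td hK]]] := T1_bounded sA mh d0.
have [C C0 phiC] := Lphi (K + 1).
pose c := Order.min 1 (e / C).
have c0 : 0 < c by rewrite !lt_min ltr01 divr_gt0.
have c1 : c <= 1 by rewrite ge_min lexx.
have cC : c <= e / C by rewrite !ge_min lexx !orbT.
have /(null_setsP chA hPJ)[AZ Z0] := hk c c0.
set Z := [set x | _] in AZ Z0.
exists (T `|` Z); split; first exact: fsetU.
  move=> x /=; rewrite -[(_ - _) x]/(phi (h x) - phi (k x)).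
  apply: contraPP => /not_orP[/hK hx /negP];
    rewrite -leNgt -[(_ - _) x]/(h x - k x) => hkx.
  apply/negP; rewrite -leNgt.
  have kx : `|k x| <= K + 1.
    rewrite -(subrK (h x) (k x)) (le_trans (ler_normD _ _))// addrC lerD//.
    by rewrite distrC; lra.
  apply: (le_trans (phiC _ _ _ kx)); first lra.
  by rewrite mulrC -ler_pdivlMr//; lra.
by have := chargeU_le chA AT AZ; lra.
Qed.

Lemma null_fun_powR (p : R) h : 1 <= p -> null_fun (fun x => `|h x| `^ p) ->
  null_fun h.
Proof.
move=> p1 hp e e0; have ep : 0 < e `^ p by rewrite powR_gt0.
apply: (null_setS chA hPJ) (hp _ ep) => x /= ex.
rewrite ger0_norm ?powR_ge0// gt0_ltr_powR ?nnegrE//; lra.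
Qed.

End NullFunctions.

(** * The integral as a lower integral *)

Section Integral.
Variables (X : Type) (R : realType) (A : set (set X)) (mu : set X -> R).
Hypotheses (chA : charge_space A mu) (hPJ : PJ_complete A mu).

Let fA : field_of_sets A. Proof. by case: chA. Qed.
Let sA : subfield A A. Proof. exact: subfieldA chA. Qed.
Local Notation N := (null_sets A mu).
Local Notation SI := (simple_integral A mu).
Local Notation "h <=_0 k" := (null_le A mu h k) (at level 70).
Let m0 : 0 <= mu setT. Proof. by apply: (charge_ge0 chA); exact: fsetT. Qed.

Lemma simple_lin (F : set (set X)) (a : R) (f g : X -> R) : field_of_sets F ->
  is_simple F f -> is_simple F g -> is_simple F (fun x => a * f x + g x).
Proof. by move=> fF; exact: (simple_op2 fF (fun x y => a * x + y)). Qed.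

Lemma simple_dist (F : set (set X)) (f g : X -> R) : field_of_sets F ->
  is_simple F f -> is_simple F g -> is_simple F (fun x => `|f x - g x|).
Proof. by move=> fF; exact: (simple_op2 fF (fun x y => `|x - y|)). Qed.

Lemma simple_integralD f g : is_simple A f -> is_simple A g ->
  SI (fun x => f x + g x) = SI f + SI g.
Proof.
move=> sf sg; rewrite -[SI f]mul1r -(simple_integral_lin chA _ sf sg).
by congr simple_integral; apply/funext => x; rewrite mul1r.
Qed.

Lemma simple_integral_ge0 f : is_simple A f -> (forall x, 0 <= f x) ->
  0 <= SI f.
Proof.
move=> sf f0; rewrite -(mul0r (mu setT)) -(simple_integral_cst chA).
by apply: (simple_integral_le chA) => //; exact: simple_cst.
Qed.

Lemma dist_simple_integral f g : is_simple A f -> is_simple A g ->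
  `|SI f - SI g| <= SI (fun x => `|f x - g x|).
Proof.
move=> sf sg; have sd := simple_dist fA sf sg.
have le1 : SI f <= SI g + SI (fun x => `|f x - g x|).
  rewrite -simple_integralD//; apply: (simple_integral_le chA) => //.
    exact: (simple_op2 fA (fun x y => x + y)).
  by move=> x; have := ler_norm (f x - g x); lra.
have le2 : SI g <= SI f + SI (fun x => `|f x - g x|).
  rewrite -simple_integralD//; apply: (simple_integral_le chA) => //.
    exact: (simple_op2 fA (fun x y => x + y)).
  by move=> x; have := ler_norm (g x - f x); rewrite distrC; lra.
by rewrite ler_norml; apply/andP; split; lra.
Qed.

Section field.
Variable F : set (set X).
Hypothesis sF : subfield A F.
Let fF : field_of_sets F. Proof. by case: sF. Qed.
Let FA : F `<=` A. Proof. by case: sF. Qed.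

(* The bound concerns simple functions over A that are below h only up to null
   sets, the approximation uses F-simple ones: this makes integrals over
   different subfields comparable. *)
Definition lower_integral (h : X -> R) (v : R) :=
  (forall r, is_simple A r -> r <=_0 h -> SI r <= v) /\
  (forall e, 0 < e -> exists r,
     [/\ is_simple F r, forall x, 0 <= r x <= h x & v - e < SI r]).

Lemma determining_cvg h u : determining_sequence F mu h u ->
  exists v : R, simple_integral F mu (u n) @[n --> \oo] --> v.
Proof.
move=> [su _ uC]; apply/cvg_ex; apply/cauchy_cvgP/cauchy_exP => e e0.
have [n0 n0e] := uC e e0; exists (simple_integral F mu (u n0)).
exists n0 => // n /= n0n; rewrite /ball/=.
rewrite !(simple_integral_sub chA sF)//.
apply: (le_lt_trans (dist_simple_integral _ _));
  [exact: (is_simpleS FA)|exact: (is_simpleS FA)|].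
rewrite -(simple_integral_sub chA sF); first exact: n0e.
exact: simple_dist.
Qed.

(** Exceptional sets contribute little: there [u n] differs from a fixed bounded [u n0] by a
    function of small integral. *)
Lemma determining_lower h u (v : R) : (forall x, 0 <= h x) ->
  determining_sequence F mu h u -> simple_integral F mu (u n) @[n --> \oo] -->
    v ->
  lower_integral h v.
Proof.
move=> h0 [su uh uC] uv.
have Asu n : is_simple A (u n) by exact: (is_simpleS FA).
(* The index [n0] comes first, so that its bound [K0] is known when [d] is chosen; only then is [n]
   taken large enough for an exceptional set of charge below [d]. *)
have main (K e : R) : 0 <= K -> 0 < e -> exists n0 n K0 d T,
  [/\ 0 <= K0 /\ (forall x, `|u n0 x| <= K0), 
      0 < d /\ 2 * d * mu setT + (K + K0) * d <= e,
      ae_close mu F h (u n) d T, SI (fun x => `|u n x - u n0 x|) < e &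
      `|SI (u n) - v| < e].
  move=> K0 e0; have [n0 n0e] := uC e e0.
  have [Ku Ku0 uKu] := simple_bounded (su n0).
  pose d := e / (2 * mu setT + (K + Ku) + 1).
  have D0 : 0 < 2 * mu setT + (K + Ku) + 1 by have := m0; lra.
  have d0 : 0 < d by rewrite divr_gt0.
  have dE : d * (2 * mu setT + (K + Ku) + 1) = e by rewrite divfK// gt_eqF.
  have [n1 n1d] := (hazy_cvgP chA sF u h).1 uh d d0.
  have /cvgrPdist_lt/(_ e e0)[n2 _ n2e] := uv.
  pose n := maxn n0 (maxn n1 n2).
  have [T [FT Td uT]] := n1d n (leq_trans (leq_maxl _ _) (leq_maxr _ _)).
  exists n0, n, Ku, d, T; split=> //.
  - by split=> //; nra.
  - by split=> // x Tx; rewrite distrC; exact: uT.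
  - rewrite -(simple_integral_sub chA sF); last exact: simple_dist.
    by apply: n0e => //; exact: leq_maxl.
  - rewrite distrC -(simple_integral_sub chA sF)//; apply: n2e.
    by rewrite /= (leq_trans (leq_maxr n1 _)) ?leq_maxr.
split=> [r sr rh|e e0].
- apply/ler_addgt0Pl => e e0; have [K K0 rK] := simple_bounded sr.
  have e30 : 0 < e / 3 by rewrite divr_gt0.
  have [n0 [n [Ku [d [T [[Ku0 uKu] [d0 dE] [FT Td hT] C1 C2]]]]]] := main K _
    K0 e30.
  have /(null_setsP chA hPJ)[AZ Z0] := rh d d0.
  set Z := [set x | _] in AZ Z0.
  have ATZ : A (T `|` Z) by apply: fsetU => //; exact: FA.
  have TZd := chargeU_le chA (FA FT) AZ.
  have sd := simple_dist fA (Asu n) (Asu n0).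
  have sud := simple_op2 fA (fun x y => x + y) (Asu n) sd.
  (* On [T] or [Z], [u n + |u n - u n0|] is at least [- Ku], hence adding [K + Ku] dominates [r].
     Elsewhere [r] exceeds [h], and [h] exceeds [u n], by at most [d] each. *)
  have := @simple_integral_bound _ _ _ _ chA r _ (2 * d) (K + Ku) _ sr sud ATZ.
  rewrite simple_integralD// => /(_ _)/wrap[|rle].
    move=> x; have := rK x; have := uKu x;
      rewrite !ler_norml => /andP[u1 u2] /andP[r1 r2].
    have du := ler_norm (u n0 x - u n x); rewrite distrC in du.
    have du0 := normr_ge0 (u n x - u n0 x).
    have [TZ|TZ] := pselect ((T `|` Z) x).
      by rewrite (mem_set TZ) mulr1; lra.
    rewrite (memNset TZ) mulr0; move/not_orP : TZ => [/hT + /negP].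
    rewrite -leNgt ler_norml => /andP[]; lra.
  have : (K + Ku) * mu (T `|` Z) <= (K + Ku) * d.
    by rewrite ler_wpM2l; lra.
  by move: C2; rewrite ltr_norml => /andP[]; lra.
- have e40 : 0 < e / 4 by rewrite divr_gt0.
  have [n0 [n [Ku [d [T [[Ku0 uKu] [d0 dE] [FT Td hT] C1 C2]]]]]] := main 0 _
    (lexx 0) e40.
  (* Off [T] this is [u n] lowered by its error and truncated at 0, hence below [h]. What is lost on
     [T] is at most [Ku + |u n - u n0|]. *)
  exists (fun x => (1 - \1_T x) * Order.max (u n x - d) 0).
  have sr : is_simple F (fun x => (1 - \1_T x) * Order.max (u n x - d) 0).
    by apply: (simple_op2 fF (fun a b => (1 - a) * Order.max (b - d) 0)) => //;
      exact: simple_indic.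
  split=> //.
    move=> x; rewrite indicE; have [Tx|Tx] := pselect (T x).
      by rewrite (mem_set Tx) subrr mul0r lexx h0.
    rewrite (memNset Tx) subr0 mul1r le_max lexx orbT/= ge_max h0 andbT.
    by have := hT x Tx; rewrite ler_norml => /andP[]; lra.
  have Asr := is_simpleS FA sr.
  have sd := simple_dist fA (Asu n) (Asu n0).
  have sud := simple_op2 fA (fun x y => x + y) Asr sd.
  have := @simple_integral_bound _ _ _ _ chA (u n) _ d Ku _ (Asu n) sud (FA FT).
  rewrite simple_integralD// => /(_ _)/wrap[|rle].
    move=> x; have := uKu x; rewrite !ler_norml => /andP[u1 u2].
    have du := ler_norm (u n x - u n0 x).
    have du0 := normr_ge0 (u n x - u n0 x).
    rewrite indicE; have [Tx|Tx] := pselect (T x).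
      by rewrite (mem_set Tx) subrr mul0r mulr1; lra.
    rewrite (memNset Tx) subr0 mul1r mulr0.
    by have [|] := leP (u n x - d) 0; lra.
  have : Ku * mu T <= Ku * d by rewrite ler_wpM2l; lra.
  have : 0 <= d * mu setT by rewrite mulr_ge0// ltW.
  by move: C2; rewrite ltr_norml => /andP[]; lra.
Qed.

(** A determining sequence has a limit, so the default 0 is never taken, and any value [xget] may
    pick comes from some determining sequence. *)
Lemma charge_integral_lower h : (forall x, 0 <= h x) ->
  charge_integrable F mu h -> lower_integral h (charge_integral F mu h).
Proof.
move=> h0 [u du]; have [v uv] := determining_cvg du.
rewrite /charge_integral; case: xgetP => [y _ [w dw wy]|].
  exact: determining_lower dw wy.
by move=> /(_ v)[]; exists u.
Qed.

Lemma integrable_T1 h : charge_integrable F mu h -> T1_measurable F mu h.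
Proof. by move=> [u [su uh _]]; exists u. Qed.

(** Running maxima [q n] of approximations from below are nondecreasing, so the integral of
    [|q n - q k|] is a difference of two terms of a bounded monotone sequence. *)
Lemma bounded_integrable h M : (forall x, 0 <= h x) -> T1_measurable F mu h ->
  (forall r, is_simple F r -> (forall x, 0 <= r x <= h x) -> SI r <= M) ->
  charge_integrable F mu h.
Proof.
move=> h0 mh hM.
have /choice[r rP] : forall n : nat, exists r, [/\ is_simple F r,
    forall x, 0 <= r x <= h x & exists T, ae_close mu F h r n.+1%:R^-1 T].
  move=> n; have [|r [T [sr rh hr]]] := T1_le_approx chA sF (e := n.+1%:R^-1)
    h0 mh.
    by rewrite invr_gt0.
  by exists r; split=> //; exists T.
pose fix q n := if n is n'.+1 then (fun x => Order.max (q n' x) (r n'.+1 x))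
  else r 0%N.
have sq n : is_simple F (q n).
  elim: n => [|n IHn] /=; first by case: (rP 0%N).
  by apply: (simple_op2 fF Order.max) => //; case: (rP n.+1).
have qh n x : 0 <= q n x <= h x.
  elim: n => [|n /andP[IH1 IH2]] /=; first by case: (rP 0%N).
  have [_ /(_ x)/andP[r1 r2] _] := rP n.+1.
  by rewrite le_max IH1/= ge_max IH2.
have rq n x : r n x <= q n x by case: n => [|n] /=;
  rewrite ?lexx// le_max lexx orbT.
have qq x : {homo q ^~ x : n k / (n <= k)%N >-> n <= k}.
  apply: (@homo_leq _ (q ^~ x) <=%R) => [y|y z t|n] //=; first exact: le_trans.
  by rewrite le_max lexx.
have Asq n : is_simple A (q n) by exact: (is_simpleS FA).
exists q; split=> //.
- apply/(hazy_cvgP chA sF) => e e0; exists (Num.truncn e^-1) => n en.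
  have [_ rh [T [FT Td hT]]] := rP n.
  have ne : n.+1%:R^-1 <= e.
    rewrite -[leRHS]invrK lef_pV2 ?posrE ?invr_gt0//.
    by rewrite (le_trans (ltW (truncnS_gt _)))// ler_nat.
  exists T; split=> //; first exact: lt_le_trans Td _.
  move=> x Tx; have := le_trans (hT x Tx) ne; have := rh x; have := rq n x;
    have := qh n x.
  move=> /andP[q1 q2] rqx /andP[r1 r2].
  clear ne; clearbody q; rewrite !ler_norml => /andP[? ?]; apply/andP; split;
    lra.
- move=> e e0; pose S := range (fun n => SI (q n)).
  have hsS : has_sup S.
    split; first by exists (SI (q 0%N)), 0%N.
    by exists M => _ [n _ <-]; exact: hM.
  have [_ [n0 _ <-] n0S] := sup_adherent e0 hsS.
  exists n0 => n k n0n n0k; rewrite (simple_integral_sub chA sF);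
    last exact: simple_dist.
  wlog nk : n k n0n n0k / (k <= n)%N.
    move=> H; have [|/ltnW] := leqP k n; first exact: H.
    move=> /(H _ _ n0k n0n); congr (simple_integral _ _ _ < _).
    by apply/funext => x; rewrite distrC.
  have -> : (fun x => `|q n x - q k x|) = (fun x => -1 * q k x + q n x).
    by apply/funext => x; rewrite ger0_norm ?subr_ge0 ?qq//; lra.
  rewrite (simple_integral_lin chA)//.
  have : SI (q n) <= sup S by apply: ub_le_sup; [case: hsS|exists n].
  have : SI (q n0) <= SI (q k) by apply: (simple_integral_le chA) => // x;
    exact: qq.
  rewrite -/S in n0S *; lra.
Qed.

Lemma integrable_lin (a : R) h k : charge_integrable F mu h ->
  charge_integrable F mu k -> charge_integrable F mu (fun x => a * h x + k x).
Proof.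
move=> [u [su /(hazy_cvgP chA sF) uh uC]] [w [sw /(hazy_cvgP chA sF) wk wC]].
have Asu n : is_simple A (u n) by exact: (is_simpleS FA).
have Asw n : is_simple A (w n) by exact: (is_simpleS FA).
have a0 : 0 < `|a| + 1 by rewrite ltr_pwDr.
have na := normr_ge0 a.
have split_e (e : R) : 0 < e -> exists2 d, 0 < d & d * (`|a| + 1) = e / 2.
  move=> e0; exists (e / 2 / (`|a| + 1)); first by rewrite !divr_gt0.
  by rewrite divfK// gt_eqF.
have tri n x (y z : R) : `|a * u n x + w n x - (a * y + z)| <=
    `|a| * `|u n x - y| + `|w n x - z|.
  by rewrite opprD addrACA -mulrBr (le_trans (ler_normD _ _))// normrM.
exists (fun n x => a * u n x + w n x); split=> [n||e e0].
- exact: simple_lin.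
- apply/(hazy_cvgP chA sF) => e e0; have [d d0 dE] := split_e e e0.
  have [n1 n1d] := uh d d0; have [n2 n2d] := wk d d0.
  exists (maxn n1 n2) => n; rewrite geq_max => /andP[/n1d[T [FT Td uT]] /n2d[S
    [FS Sd wS]]].
  exists (T `|` S); split; first exact: fsetU.
    by have := chargeU_le chA (FA FT) (FA FS); nra.
  move=> x /not_orP[/uT ux /wS wx]; apply: (le_trans (tri _ _ _ _)); nra.
- have [d d0 dE] := split_e e e0.
  have [n1 n1d] := uC d d0; have [n2 n2d] := wC d d0.
  exists (maxn n1 n2) => n l; rewrite !geq_max => /andP[n1n n2n] /andP[n1l n2l].
  have := n1d n l n1n n1l; have := n2d n l n2n n2l.
  have sub f := @simple_integral_sub _ _ _ _ chA F f sF.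
  rewrite (sub _ (simple_dist fF (su n) (su l))) (sub _ (simple_dist fF (sw n)
    (sw l))).
  have sl i := simple_lin a fF (su i) (sw i).
  rewrite (sub _ (simple_dist fF (sl n) (sl l))).
  have sdu := simple_dist fA (Asu n) (Asu l);
    have sdw := simple_dist fA (Asw n) (Asw l).
  have := @simple_integral_le _ _ _ _ chA (fun x => `|a * u n x + w n x - (a *
    u l x + w l x)|)
    (fun x => `|a| * `|u n x - u l x| + `|w n x - w l x|) _ _ _.
  rewrite (simple_integral_lin chA)// => /(_ _ _ _)/wrap[||x|].
  + by apply: simple_dist => //; exact: simple_lin.
  + exact: simple_lin.
  + exact: tri.
  + have := simple_integral_ge0 sdu (fun x => normr_ge0 _).
    nra.
Qed.

End field.
End Integral.

(** * Lp spaces over subfields *)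

Section Lp.
Variables (X : Type) (R : realType) (A : set (set X)) (mu : set X -> R).
Hypotheses (chA : charge_space A mu) (hPJ : PJ_complete A mu).

Let fA : field_of_sets A. Proof. by case: chA. Qed.
Let sA : subfield A A. Proof. exact: subfieldA chA. Qed.
Local Notation N := (null_sets A mu).
Local Notation SI := (simple_integral A mu).
Local Notation "h <=_0 k" := (null_le A mu h k) (at level 70).
Let m0 : 0 <= mu setT. Proof. by apply: (charge_ge0 chA); exact: fsetT. Qed.

(** An [F]-simple function below [h] is below [k] up to null sets, and the upper bound in
    [lower_integral] covers all [A]-simple functions, hence those over [F]. *)
Lemma charge_integral_le F G h k : subfield A F -> subfield A G ->
  (forall x, 0 <= h x) -> (forall x, 0 <= k x) ->
  charge_integrable F mu h -> charge_integrable G mu k -> h <=_0 k ->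
  charge_integral F mu h <= charge_integral G mu k.
Proof.
move=> sF sG h0 k0 ih ik hk.
have [_ hr] := charge_integral_lower chA hPJ sF h0 ih.
have [kr _] := charge_integral_lower chA hPJ sG k0 ik.
apply/ler_addgt0Pl => e e0; have [r [sr rh re]] := hr e e0.
have : SI r <= charge_integral G mu k.
  apply: kr; first exact: is_simpleS sF.2 sr.
  apply: null_le_trans hk => //; apply: null_le_pw => // x.
  by have /andP[] := rh x.
by lra.
Qed.

Lemma integrable_dominated F G h k : subfield A F -> subfield A G ->
  (forall x, 0 <= h x) -> (forall x, 0 <= k x) ->
  T1_measurable F mu h -> charge_integrable G mu k -> h <=_0 k ->
  charge_integrable F mu h.
Proof.
move=> sF sG h0 k0 mh ik hk.
have [kr _] := charge_integral_lower chA hPJ sG k0 ik.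
apply: (bounded_integrable chA sF (M := charge_integral G mu k)) => // r sr rh.
apply: kr; first exact: is_simpleS sF.2 sr.
apply: null_le_trans hk => //; apply: null_le_pw => // x.
by have /andP[] := rh x.
Qed.

Section field.
Variable F : set (set X).
Hypothesis sF : subfield A F.
Let fF : field_of_sets F. Proof. by case: sF. Qed.
Let FA : F `<=` A. Proof. by case: sF. Qed.

Lemma integrable_of_bounded (h : X -> R) K : (forall x, 0 <= h x <= K) ->
  T1_measurable F mu h -> charge_integrable F mu h.
Proof.
move=> hK mh; apply: (bounded_integrable chA sF (M := K * mu setT)) => //.
  by move=> x; have /andP[] := hK x.
move=> r sr rh; rewrite -(simple_integral_cst chA).
apply: (simple_integral_le chA) => [||x].
- exact: is_simpleS sr.
- exact: simple_cst.
- by have := hK x; have := rh x => /andP[_ +] /andP[_]; exact: le_trans.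
Qed.

Lemma charge_integral_ge0 h : (forall x, 0 <= h x) ->
  charge_integrable F mu h ->
  0 <= charge_integral F mu h.
Proof.
move=> h0 ih; have [hr _] := charge_integral_lower chA hPJ sF h0 ih.
rewrite -(mul0r (mu setT)) -(simple_integral_cst chA); apply: hr.
  exact: simple_cst.
exact: null_le_pw.
Qed.

Lemma charge_integral0 : charge_integral F mu (fun=> 0) = 0.
Proof.
have s0 := simple_cst fF (0 : R).
have i0 : charge_integrable F mu (fun=> 0).
  by apply: (@integrable_of_bounded _ 0) => [x|];
    [rewrite lexx|exact: (simple_T1 chA sF s0)].
apply/eqP; rewrite eq_le charge_integral_ge0// andbT.
have [_ hr] := charge_integral_lower chA hPJ sF (fun=> lexx 0) i0.
apply/ler_addgt0Pl => e e0; have [r [sr r0]] := hr e e0.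
have -> : r = fun=> 0 by apply/funext => x; apply/eqP; rewrite eq_le andbC r0.
by rewrite (simple_integral_cst chA) mul0r; lra.
Qed.

(** A Chebyshev argument on a simple approximation: [e - 2 * c] times the indicator of [S] lies
    below [h], so a zero integral forces [mu S] to vanish. *)
Lemma charge_integral_eq0 h : (forall x, 0 <= h x) ->
  charge_integrable F mu h ->
  charge_integral F mu h = 0 -> null_fun A mu h.
Proof.
move=> h0 ih hI; have [hr _] := charge_integral_lower chA hPJ sF h0 ih.
have /(T1_measurableP chA sF) mh := integrable_T1 ih.
move=> e e0; apply: (null_small chA) => d d0.
pose c := Order.min (d / 2) (e / 4).
have c0 : 0 < c by rewrite lt_min !divr_gt0.
have cd : c <= d / 2 by rewrite ge_min lexx.
have ce : c <= e / 4 by rewrite ge_min lexx orbT.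
have [s [T [ss [FT Tc hT]]]] := mh c c0.
have hs x : ~ T x -> s x - c <= h x /\ h x <= s x + c.
  by move=> /hT; rewrite ler_norml => /andP[]; lra.
pose S := [set x | e - c < s x] `\` T.
have FS : F S by apply: fsetD => //; exact: (simple_pre fF (fun y => e - c < y)
  ss).
have sS := simple_indic fA R (FA FS).
have S0 : mu S <= 0.
  have := simple_integral_lin chA (e - 2 * c) sS (simple_cst fA (0 : R)).
  rewrite (simple_integral_indic chA)// ?(simple_integral_cst chA)//;
    last exact: FA.
  rewrite mul0r addr0 => SE.
  have : (e - 2 * c) * mu S <= 0.
    rewrite -SE -[leRHS]hI; apply: hr.
      by apply: simple_lin => //; exact: simple_cst.
    apply: null_le_pw => // x /=; rewrite addr0 indicE;
      have [Sx|Sx] := pselect (S x).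
      by rewrite (mem_set Sx) mulr1; case: Sx => /= ? /hs; lra.
    by rewrite (memNset Sx) mulr0.
  by rewrite pmulr_rle0//; lra.
exists (S `|` T); split; first by apply: FA; exact: fsetU.
  move=> x /=; rewrite ger0_norm// => ex; have [|Tx] := pselect (T x);
    first by right.
  by left; split => //=; have := hs x Tx; lra.
by have := chargeU_le chA (FA FS) (FA FT); lra.
Qed.

Variable p : R.
Hypothesis hp : p = 0 \/ 1 <= p.

Lemma Lp_T1 f : Lp F mu p f -> T1_measurable F mu f.
Proof. by rewrite /Lp; case: ifP => _ // -[]. Qed.

Let p_neq0 : p != 0 -> 1 <= p.
Proof. by case: hp => [->|//]; rewrite eqxx. Qed.

Let ge0p (f : X -> R) x : 0 <= `|f x| `^ p. Proof. exact: powR_ge0. Qed.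

Lemma Lp_bounded f K : T1_measurable F mu f -> (forall x, `|f x| <= K) ->
  Lp F mu p f.
Proof.
move=> mf fK; rewrite /Lp; have [//|/p_neq0 p1] := eqVneq p 0.
split=> //; apply: (@integrable_of_bounded _ (K `^ p)).
  move=> x; rewrite ge0p ge0_ler_powR ?nnegrE//; first lra.
  exact: le_trans (normr_ge0 _) (fK x).
exact: (T1_comp chA sF (locally_lipschitz_powR p1)).
Qed.

Lemma Lp_simple s : is_simple F s -> Lp F mu p s.
Proof.
move=> ss; have [K _ sK] := simple_bounded ss.
by apply: Lp_bounded sK; exact: (simple_T1 chA sF ss).
Qed.

(** For [p >= 1], with [b = |a| + 1], the power [|a f + g| ^ p] is dominated by [(2 b) ^ p] times
    [|f| ^ p + |g| ^ p], through the maximum of [|f|] and [|g|]. *)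
Lemma Lp_lin (a : R) f g : Lp F mu p f -> Lp F mu p g -> Lp F mu p (a *: f + g).
Proof.
rewrite /Lp; have [_|/p_neq0 p1] := eqVneq p 0; first by move=> ? ?;
  exact: (T1_lin chA sF).
move=> [mf fi] [mg gi]; have mfg := T1_lin chA sF a mf mg.
split; first exact: mfg.
pose b := `|a| + 1; have b1 : 1 <= b by rewrite lerDr.
have mfgp := T1_comp chA sF (locally_lipschitz_powR p1) mfg.
have i0 : charge_integrable F mu (fun=> 0).
  by apply: (@integrable_of_bounded _ 0) => [x|];
    [rewrite lexx|exact: (simple_T1 chA sF (simple_cst fF _))].
pose c := (b *+ 2) `^ p.
have iC := integrable_lin chA sF c fi (integrable_lin chA sF c gi i0).
have c0 : 0 <= c by exact: powR_ge0.
apply: (integrable_dominated sF sF _ _ mfgp iC).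
- by move=> x; exact: ge0p.
- by move=> x; rewrite addr0 addr_ge0// mulr_ge0.
- apply: null_le_pw => // x /=; rewrite addr0.
  rewrite -[(_ + _) x]/(a * f x + g x).
  pose M := Order.max `|f x| `|g x|.
  have M0 : 0 <= M by rewrite le_max normr_ge0.
  have fM : `|f x| <= M by rewrite le_max lexx.
  have gM : `|g x| <= M by rewrite le_max lexx orbT.
  have na := normr_ge0 a.
  apply: (@le_trans _ _ ((b *+ 2 * M) `^ p)).
    apply: ge0_ler_powR; rewrite ?nnegrE//; first lra.
      by rewrite mulr_ge0//; lra.
    rewrite (le_trans (ler_normD _ _))// normrM mulr2n mulrDl /b.
    by nra.
  rewrite powRM//; last lra.
  rewrite -/c -mulrDr ler_wpM2l// /M.
  by have [|] := leP `|f x| `|g x|; rewrite ?lerDl ?lerDr ge0p.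
Qed.

Lemma LpB f g : Lp F mu p f -> Lp F mu p g -> Lp F mu p (f - g).
Proof. by move=> Lf /(Lp_lin (-1))/(_ Lf); rewrite scaleN1r addrC. Qed.

Lemma L0_dist_has_inf (f g : X -> R) :
  has_inf [set e : R | 0 < e /\ outer_charge F mu [set x | e < `|f x - g x|] <
    e].
Proof.
split; last by exists 0 => e [/ltW].
exists (mu setT + 1); split; first by have := m0; lra.
by apply: le_lt_trans (outer_charge_le chA sF (fsetT fF) _) _ => //; lra.
Qed.

Lemma L0_dist_le (f g : X -> R) e : 0 < e ->
  outer_charge F mu [set x | e < `|f x - g x|] < e -> L0_dist F mu f g <= e.
Proof. by move=> e0 fge; apply: ge_inf => //; case: (L0_dist_has_inf f g). Qed.


(** The approximant is [s] cut to 0 on [T]: the error is at most [d] off [T] and is [|f| ^ p] on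
    [T]. The latter has small integral because a bounded simple [r] already nearly exhausts the
    integral of [|f| ^ p]. *)
Lemma Lp_approx f e : p != 0 -> Lp F mu p f -> 0 < e ->
  exists2 s, is_simple F s & charge_integral F mu (fun x => `|(f - s) x| `^ p)
    <= e.
Proof.
move=> pN0; have p1 := p_neq0 pN0 => Lf e0.
have Lf2 := Lf; move: Lf2; rewrite /Lp (negPf pN0) => -[mf fi].
have [fr fa] := charge_integral_lower chA hPJ sF (ge0p f) fi.
set If := charge_integral F mu _ in fr fa; move: If fr fa => If fr fa.
have e40 : 0 < e / 4 by rewrite divr_gt0.
have [r [sr rf re]] := fa _ e40.
have [K K0 rK] := simple_bounded sr.
pose D := mu setT + K + 1.
have D0 : 0 < D by rewrite /D; have := m0; lra.
pose d := Order.min 1 (e / 4 / D).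
have d0 : 0 < d by rewrite lt_min ltr01 divr_gt0.
have d1 : d <= 1 by rewrite ge_min lexx.
have dD : d * D <= e / 4 by rewrite -ler_pdivlMr// ge_min lexx orbT.
clearbody d.
have [s [T [ss [FT Td fT]]]] := (T1_measurableP chA sF f).1 mf d d0.
have sT := simple_indic fF R FT.
pose t x := (1 - \1_T x) * s x.
have st : is_simple F t by exact: (simple_op2 fF (fun a b => (1 - a) * b)).
exists t => //; have Lt := Lp_simple st.
have := LpB Lf Lt; rewrite /Lp (negPf pN0) => -[_ hi].
have [_ ha] := charge_integral_lower chA hPJ sF (ge0p (f - t)) hi.
set Ih := charge_integral F mu _ in ha *; move: Ih ha => Ih ha.
apply/ler_addgt0Pl => c c0; have [r' [sr' rf' re']] := ha _ c0.
have hE x : T x -> `|(f - t) x| `^ p = `|f x| `^ p.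
  by move=> Tx; rewrite -[(_ - _) x]/(f x - t x) /t indicE (mem_set Tx) subrr
    mul0r subr0.
have hd x : ~ T x -> `|(f - t) x| `^ p <= d.
  move=> Tx; rewrite -[(_ - _) x]/(f x - t x) /t indicE (memNset Tx) subr0
    mul1r.
  apply: (@le_trans _ _ (d `^ p)); last by apply: ge1r_powR => //; rewrite d0.
  by apply: ge0_ler_powR; [lra|rewrite nnegrE|rewrite nnegrE ltW|exact: fT].
(* The pasted function stays below [|f| ^ p], so its integral exceeds that of [r] by at most
   [e / 4]. Up to [d] off [T] and [K] on [T], the difference [r2 - r] dominates [r']. *)
pose r2 x := if x \in T then r' x else r x.
have sr2 : is_simple F r2 by exact: simple_if.
have r2T x : T x -> r2 x = r' x.
  by move=> Tx; rewrite /r2 mem_set.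
have r2NT x : ~ T x -> r2 x = r x.
  by move=> Tx; rewrite /r2 memNset.
have := fr r2 (is_simpleS FA sr2) => /(_ _)/wrap[|r2f].
  apply: null_le_pw => // x; have [Tx|Tx] := pselect (T x).
    by rewrite r2T// -hE//; case/andP: (rf' x).
  by rewrite r2NT//; case/andP: (rf x).
have Ar := is_simpleS FA sr; have Ar' := is_simpleS FA sr'.
have Ar2 := is_simpleS FA sr2.
have := @simple_integral_bound _ _ _ _ chA r' _ d K T Ar' (simple_lin (-1) fA
  Ar Ar2) (FA FT).
rewrite (simple_integral_lin chA)// => /(_ _)/wrap[|bd].
  move=> x; have := rK x; rewrite ler_norml => /andP[r1 r3].
  have [Tx|Tx] := pselect (T x); first by rewrite r2T// (mem_set Tx) mulr1; lra.
  rewrite r2NT// (memNset Tx) mulr0.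
  by have := hd x Tx; case/andP: (rf' x); lra.
have : K * mu T <= K * d by rewrite ler_wpM2l// ltW.
by move: dD; rewrite /D; lra.
Qed.

End field.

(** Integrability passes between fields by domination up to null sets; measurability over [F] has to
    be supplied. *)
Lemma Lp_transfer F G p (f g : X -> R) : subfield A F -> subfield A G ->
  p = 0 \/ 1 <= p -> T1_measurable F mu g -> Lp G mu p f ->
  null_fun A mu (f - g) -> Lp F mu p g.
Proof.
move=> sF sG hp mg; rewrite /Lp; have [//|pN0] := eqVneq p 0.
have p1 : 1 <= p by case: hp pN0 => [->|//]; rewrite eqxx.
have pL := locally_lipschitz_powR p1.
move=> [mf fi] fg; split=> //.
apply: (integrable_dominated sF sG _ _ (T1_comp chA sF pL mg) fi).
- by move=> x; exact: powR_ge0.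
- by move=> x; exact: powR_ge0.
- apply: null_fun_le => //; apply: null_funC => //.
  by apply: null_fun_comp => //; exact: (T1_sub chA sG sA sG.2).
Qed.

Lemma Lp_sub F G p : subfield A F -> subfield A G -> p = 0 \/ 1 <= p ->
  F `<=` G -> Lp F mu p `<=` Lp G mu p.
Proof.
move=> sF sG hp FG f Lf; apply: (Lp_transfer sG sF hp _ Lf).
  by apply: (T1_sub chA sF sG FG); exact: Lp_T1 Lf.
by rewrite subrr; exact: null_fun0.
Qed.

Lemma Lp_dist_le F G p (f g f' g' : X -> R) : subfield A F -> subfield A G ->
  p = 0 \/ 1 <= p -> Lp F mu p f -> Lp F mu p g -> Lp G mu p f' ->
    Lp G mu p g' ->
  null_fun A mu ((f - g) - (f' - g')) ->
  Lp_dist F mu p f g <= Lp_dist G mu p f' g'.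
Proof.
move=> sF sG hp Lf Lg Lf' Lg' hh'.
have Lh := LpB sF hp Lf Lg; have Lh' := LpB sG hp Lf' Lg'.
have mh := Lp_T1 Lh; move: Lh Lh'; rewrite /Lp_dist /Lp.
have [_ _ _|pN0] := eqVneq p 0.
  set h := f - g in hh' mh; set h' := f' - g' in hh'.
  apply: lb_le_inf; first by case: (L0_dist_has_inf sG f' g').
  move=> e [e0 /(outer_charge_ltP chA sG)[C [GC hC Ce]]].
  apply/ler_addgt0Pl => d d0; have d30 : 0 < d / 3 by rewrite divr_gt0.
  rewrite addrC; apply: L0_dist_le => //; first lra.
  have [s [T [ss [FT Td hT]]]] := (T1_measurableP chA sF h).1 mh _ d30.
  have /(null_setsP chA hPJ)[AZ Z0] := hh' _ d30.
  set Z := [set x | _] in AZ Z0.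
  (* [W] brings the cover [C] from [G] to [F]. Off [T] and [Z], [s] is within [2 d / 3] of [h'], so
     [W] lies in [C] up to the null set [Z], while [W] and [T] cover [{|h| > e + d}]. *)
  pose W := [set x | e + d / 3 *+ 2 < `|s x|] `\` T.
  have fF := sF.1; have FA := sF.2; have GA := sG.2.
  have FW : F W.
    by apply: fsetD => //; exact: (simple_pre fF (fun y => e + d / 3 *+ 2 <
      `|y|) ss).
  apply: (@le_lt_trans _ _ (mu (W `|` T))).
    apply: (outer_charge_le chA sF); first exact: fsetU.
    move=> x /=; rewrite -[f x - g x]/(h x) => hx.
    have [|Tx] := pselect (T x); first by right.
    left; split => //=; have := hT x Tx.
    by have := ler_normD (h x - s x) (s x); rewrite subrK mulr2n; lra.
  have := chargeU_le chA (FA _ FW) (FA _ FT).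
  have := chargeU_le chA (GA _ GC) AZ.
  have : mu W <= mu (C `|` Z).
    apply: (charge_le chA); [exact: FA|by apply: fsetU => //; exact: GA|].
    move=> x [/= sx Tx]; have [|Zx] := pselect (Z x); first by right.
    left; apply: hC => /=; rewrite -[f' x - g' x]/(h' x).
    move/negP : Zx; rewrite -leNgt -[(_ - _) x]/(h x - h' x).
    have := hT x Tx; rewrite (distrC (h x) (s x)) => h1 h2.
    have := ler_normD (s x - h x) (h x); rewrite subrK.
    have := ler_normD (h x - h' x) (h' x); rewrite subrK.
    by move: sx; rewrite mulr2n; lra.
  by lra.
have p1 : 1 <= p by case: hp pN0 => [->|//]; rewrite eqxx.
have pL := locally_lipschitz_powR p1.
move=> [_ hi] [_ hi']; rewrite /Lp_norm.
have p0 (k : X -> R) x : 0 <= `|k x| `^ p by exact: powR_ge0.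
apply: ge0_ler_powR; rewrite ?nnegrE ?invr_ge0//; [lra| | |].
- exact: (charge_integral_ge0 sF).
- exact: (charge_integral_ge0 sG).
- apply: charge_integral_le => //; apply: null_fun_le => //.
  exact: (null_fun_comp chA hPJ pL (T1_sub chA sF sA sF.2 mh) hh').
Qed.

Lemma Lp_dist_congr F G p (f g f' g' : X -> R) : subfield A F -> subfield A G ->
  p = 0 \/ 1 <= p -> Lp F mu p f -> Lp F mu p g -> Lp G mu p f' ->
    Lp G mu p g' ->
  null_fun A mu ((f - g) - (f' - g')) ->
  Lp_dist F mu p f g = Lp_dist G mu p f' g'.
Proof.
move=> sF sG hp Lf Lg Lf' Lg' hh'; apply/eqP; rewrite eq_le; apply/andP; split.
  exact: (Lp_dist_le sF sG hp Lf Lg Lf' Lg' hh').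
exact: (Lp_dist_le sG sF hp Lf' Lg' Lf Lg (null_funC chA hPJ hh')).
Qed.

Lemma Lp_distxx F p (f : X -> R) : subfield A F -> p = 0 \/ 1 <= p ->
  Lp_dist F mu p f f = 0.
Proof.
move=> sF hp; rewrite /Lp_dist; have [_|pN0] := eqVneq p 0.
  apply/eqP; rewrite eq_le; apply/andP; split.
    apply/ler_addgt0Pl => e e0; rewrite addr0; apply: L0_dist_le => //.
    apply: le_lt_trans (outer_charge_le chA sF (fset0 sF.1) _) _.
      by move=> x /=; rewrite subrr normr0; lra.
    by rewrite (charge_set0 chA).
  apply: lb_le_inf; first by case: (L0_dist_has_inf sF f f).
  by move=> e [/ltW].
rewrite /Lp_norm subrr (_ : (fun x => _) = fun=> 0); last first.
  by apply/funext => x; rewrite -[(0 : X -> R) x]/(0 : R) normr0 powR0.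
by rewrite charge_integral0// powR0// invr_eq0.
Qed.

(** The criterion refers to [A] alone, so the equivalence relations over different subfields
    coincide where both are defined. *)
Lemma Lp_dist_eq0 F p (f g : X -> R) : subfield A F -> p = 0 \/ 1 <= p ->
  Lp F mu p f -> Lp F mu p g -> Lp_dist F mu p f g = 0 <-> null_fun A mu (f -
    g).
Proof.
move=> sF hp Lf Lg; split=> [|fg]; last first.
  rewrite -(Lp_distxx f sF hp); apply: Lp_dist_congr => //.
  by rewrite subrr subr0.
have := LpB sF hp Lf Lg; rewrite /Lp_dist /Lp.
have [_ _ fg0 e e0|pN0 [_ hi]] := eqVneq p 0.
  apply: (null_small chA) => d d0.
  have c0 : 0 < Order.min e d by rewrite lt_min e0.
  have [c [c1 cc] cm] := inf_adherent c0 (L0_dist_has_inf sF f g).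
  move: cm; rewrite -/(L0_dist F mu f g) fg0 add0r lt_min => /andP[ce cd].
  have [B [FB hB Bc]] := (outer_charge_ltP chA sF _ _).1 cc.
  exists B; split; [exact: sF.2|move=> x /= ex; apply: hB|] => /=; last lra.
  exact: lt_trans ex.
have p1 : 1 <= p by case: hp pN0 => [->|//]; rewrite eqxx.
move=> /powR_eq0_eq0/(charge_integral_eq0 sF) H.
by apply: (null_fun_powR chA hPJ p1); apply: H => // x; exact: powR_ge0.
Qed.

Lemma simple_dense F p (f : X -> R) e : subfield A F -> p = 0 \/ 1 <= p ->
  Lp F mu p f -> 0 < e -> exists2 s, is_simple F s & Lp_dist F mu p f s < e.
Proof.
move=> sF hp Lf e0; have e20 : 0 < e / 2 by rewrite divr_gt0.
rewrite /Lp_dist; have [p0|pN0] := eqVneq p 0.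
  have [s [T [ss [FT Te fT]]]] := (T1_measurableP chA sF f).1 (Lp_T1 Lf) _ e20.
  exists s => //; apply: (@le_lt_trans _ _ (e / 2)); last lra.
  apply: L0_dist_le => //; apply/(outer_charge_ltP chA sF); exists T;
    split=> //.
  by move=> x /=; apply: contraPP => /fT; rewrite leNgt => /negP.
have p1 : 1 <= p by case: hp pN0 => [->|//]; rewrite eqxx.
have [|s ss fs] := Lp_approx sF hp (e := (e / 2) `^ p) pN0 Lf;
  first exact: powR_gt0.
exists s => //; have Ls := Lp_simple sF hp ss.
have := LpB sF hp Lf Ls; rewrite /Lp (negPf pN0) => -[_ hi].
apply: (@le_lt_trans _ _ (((e / 2) `^ p) `^ p^-1)).
  apply: ge0_ler_powR; rewrite ?nnegrE ?invr_ge0 ?powR_ge0//; first lra.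
  by apply: charge_integral_ge0 => // x; exact: powR_ge0.
by rewrite -powRrM divff// powRr1; lra.
Qed.

End Lp.

(** * Adjoining null sets *)

Lemma field_generated_field (X : Type) (C : set (set X)) :
  field_of_sets (field_generated C).
Proof.
split.
- by move=> G [[]].
- by move=> E CE G [fG CG]; apply: fsetC => //; exact: CE.
- by move=> D E CD CE G [fG CG]; apply: fsetU => //; [exact: CD|exact: CE].
Qed.

Lemma sub_field_generated (X : Type) (C : set (set X)) : C `<=` field_generated
  C.
Proof. by move=> E CE G [_]; exact. Qed.

Lemma field_generated_min (X : Type) (C G : set (set X)) : field_of_sets G ->
  C `<=` G -> field_generated C `<=` G.
Proof. by move=> fG CG E; apply. Qed.

Section ModuloNull.
Variables (X : Type) (R : realType) (A : set (set X)) (mu : set X -> R).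
Hypotheses (chA : charge_space A mu) (hPJ : PJ_complete A mu).

Let fA : field_of_sets A. Proof. by case: chA. Qed.
Let sA : subfield A A. Proof. exact: subfieldA chA. Qed.
Local Notation N := (null_sets A mu).

Definition eq_mod_null (F : set (set X)) (E : set X) := exists E' Z,
  [/\ F E', N Z & forall x, ~ Z x -> E x <-> E' x].

(** The sets that agree with a member of [F] off a null set form a field containing [F] and the null
    sets. *)
Lemma generated_mod_null F E : field_of_sets F ->
  field_generated (F `|` N) E -> eq_mod_null F E.
Proof.
move=> fF; have null0 := null_set0 chA hPJ.
apply: field_generated_min.
- split.
  + by exists set0, set0; split; [exact: fset0|exact: null0|].
  + move=> D [D' [Z [FD NZ DD]]]; exists (~` D'), Z; split=> //;
    first exact: fsetC.
    by move=> x /DD; rewrite /setC/=; tauto.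
  + move=> C D [C' [Y [FC NY CC]]] [D' [Z [FD NZ DD]]].
    exists (C' `|` D'), (Y `|` Z); split;
      [exact: fsetU|exact: (null_setU chA hPJ)|].
    by move=> x /not_orP[/CC ? /DD ?]; rewrite /setU/=; tauto.
- move=> D [FD|ND]; first by exists D, set0; split.
  by exists set0, D; split=> //; exact: fset0.
Qed.

Lemma mod_null_generated F E : eq_mod_null F E -> field_generated (F `|` N) E.
Proof.
move=> [E' [Z [FE NZ EE]]].
have fG := field_generated_field (F `|` N).
have -> : E = (E' `\` Z) `|` (E `&` Z).
  apply/seteqP; split=> x.
    by move=> Ex; have [|Zx] := pselect (Z x); [right|left; split=> //;
      exact/EE].
  by move=> [[Ex Zx]|[]//]; exact/EE.
apply: (fsetU fG).
  by apply: (fsetD fG); apply: sub_field_generated; [left|right].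
by apply: sub_field_generated; right; apply: (null_setS chA hPJ) NZ => x [].
Qed.

Lemma subfield_generated F : subfield A F ->
  subfield A (field_generated (F `|` N)).
Proof.
move=> [fF FA]; split; first exact: field_generated_field.
apply: field_generated_min => // E [|/(null_setsP chA hPJ)[]//]; exact: FA.
Qed.

Lemma simple_mod_null G H (s : X -> R) : field_of_sets G -> field_of_sets H ->
  (forall E, G E -> eq_mod_null H E) -> is_simple G s ->
  exists s' Z, [/\ is_simple H s', N Z & forall x, ~ Z x -> s x = s' x].
Proof.
move=> fG fH GH; apply: (simple_transfer (Q := fun _ Z => N Z) fG fH _ _ ltr01).
  by move=> _ _ D E; exact: (null_setU chA hPJ).
by move=> _ E _; exact: GH.
Qed.

(** At each stage only finitely many null sets have been met, so [g n] agrees with [s n] up to a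
    null set, while off [T n] the later steps of [g] are bounded by a geometric series at every
    point. *)
Lemma T1_clip_limit H (f : X -> R) (s : nat -> X -> R) (T : nat -> set X) :
  subfield A H -> (forall n, is_simple H (s n)) -> (forall n, H (T n)) ->
  (forall n, T n.+1 `<=` T n) -> (forall n, mu (T n) < 2^-1 ^+ n) ->
  (forall n, exists2 W, N W &
     forall x, ~ W x -> ~ T n x -> `|f x - s n x| <= 2^-1 ^+ n) ->
  exists2 g, T1_measurable H mu g & null_fun A mu (f - g).
Proof.
move=> sH ss HT TS Tn fs; have [fH HA] := sH.
pose h n : R := 2^-1 ^+ n.
have h0 n : 0 < h n by exact: half_pow_gt0.
have hS n : h n.+1 = h n / 2 by rewrite /h exprSr.
pose fix g n := if n is n'.+1 then fun x => if x \in T n' then s n'.+1 x else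
  Order.max (g n' x - 2 * h n') (Order.min (g n' x + 2 * h n') (s n'.+1 x))
    else s 0%N.
have gS n x : g n.+1 x = if x \in T n then s n.+1 x else
  Order.max (g n x - 2 * h n) (Order.min (g n x + 2 * h n) (s n.+1 x)) by [].
have sg n : is_simple H (g n).
  elim: n => [|n IHn]; first exact: ss.
  apply: (simple_if fH (HT n)) => //.
  exact: (simple_op2 fH (fun a b => Order.max (a - 2 * h n) (Order.min (a + 2 *
    h n) b))).
(* Where [s n] and [s n.+1] are both close to [f], they differ by at most [h n + h n.+1 < 2 * h n],
   and clipping changes nothing. *)
have gs n : exists2 W, N W & forall x, ~ W x ->
    g n x = s n x /\ (~ T n x -> `|f x - s n x| <= h n).
  elim: n => [|n [W NW gsW]].
    by have [W NW fW] := fs 0%N; exists W => // x Wx; split=> //; exact: fW.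
  have [Y NY fY] := fs n.+1; exists (W `|` Y); first exact: (null_setU chA hPJ).
  move=> x /not_orP[/gsW[gsx fsx] /fY fsx']; split=> //; rewrite gS.
  have [//|/negP Tx] := boolP (x \in T n).
  have {}Tx : ~ T n x by move=> /mem_set.
  have := fsx' (fun t => Tx (TS n x t)); have := fsx Tx.
  rewrite -/(h n.+1) hS gsx !ler_norml => /andP[f1 f2] /andP[f3 f4].
  have hn := h0 n.
  rewrite min_r; last lra.
  by rewrite max_r//; lra.
have gstep n x : ~ T n x -> `|g n.+1 x - g n x| <= 2 * h n.
  move=> Tx; rewrite gS memNset// ler_norml; have hn := h0 n.
  have [?|?] := leP (g n x + 2 * h n) (s n.+1 x).
    by have [?|?] := leP (g n x - 2 * h n) (g n x + 2 * h n); apply/andP;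
      split; lra.
  by have [?|?] := leP (g n x - 2 * h n) (s n.+1 x); apply/andP; split; lra.
have TS' n m x : (n <= m)%N -> ~ T n x -> ~ T m x.
  move=> /subnK <-; elim: (m - n)%N => // k IHk /IHk; rewrite addSn => Tx /TS.
  exact: Tx.
(* The bound is the telescoped sum of the steps [2 * h k] for [k] from [n] to [m - 1]. *)
have gdist n m x : (n <= m)%N -> ~ T n x ->
  `|g m x - g n x| <= 4 * h n - 4 * h m.
  move=> /subnK <- Tx; elim: (m - n)%N => [|k IHk];
    first by rewrite !subrr normr0.
  have := gstep _ _ (TS' n (k + n)%N x (leq_addl _ _) Tx).
  have := ler_normD (g (k + n).+1 x - g (k + n)%N x) (g (k + n)%N x - g n x).
  by rewrite addSn addrA subrK hS; lra.
have /choice[g_ gP] : forall x, exists y, forall n, ~ T n x ->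
    g n x - 4 * h n <= y /\ y <= g n x + 4 * h n.
  move=> x; apply: (@cut_point R (fun n => ~ T n x) (fun n => g n x - 4 * h n)
    (fun n => g n x + 4 * h n)) => n m Tn' Tm.
  have hn := h0 n; have hm := h0 m.
  have [/gdist|/ltnW/gdist] := leqP n m.
    by move=> /(_ x Tn'); rewrite ler_norml => /andP[]; lra.
  by move=> /(_ x Tm); rewrite ler_norml => /andP[]; lra.
exists g_.
  apply/(T1_measurableP chA sH) => e e0.
  have [|n ne] := @half_pow_lt R (e / 4); first by rewrite divr_gt0.
  exists (g n), (T n); split=> //; split=> //; first by have := Tn n; lra.
  move=> x /gP; rewrite ler_norml => -[? ?]; apply/andP.
  by rewrite -/(h n) in ne; split; lra.
move=> e e0; apply: (null_small chA) => d d0.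
(* The 5 adds one [h n] from [f] to [s n] and four from [g n] to the limit. *)
have [|n ne] := @half_pow_lt R (Order.min (e / 5) d).
  by rewrite lt_min divr_gt0.
move: ne; rewrite lt_min => /andP[ne nd]; have [W NW gsW] := gs n.
have [AW W0] := (null_setsP chA hPJ W).1 NW.
exists (T n `|` W); split.
- by apply: fsetU => //; exact: HA.
- move=> x /=; apply: contraPP => /not_orP[Tx Wx]; apply/negP.
  have [gsx fsx] := gsW x Wx; have := fsx Tx; have := gP x n Tx.
  rewrite -/(h n) in ne; rewrite gsx -[(_ - _) x]/(f x - g_ x) -leNgt
    !ler_norml.
  by move=> [? ?] /andP[? ?]; apply/andP; split; lra.
- by have := chargeU_le chA (HA _ (HT n)) AW; have := Tn n; lra.
Qed.

(** Levels cannot be prescribed, only found in a given interval. From [- L] upwards, successive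
    levels are more than [d / 2] apart, so finitely many pass [L], and less than [d] apart, so the
    last level below [f] is a good approximation. *)
Lemma T1_range_approx F (f : X -> R) (L d : R) : subfield A F ->
  T1_measurable F mu f ->
  0 <= L -> 0 < d -> exists2 s, is_simple (PJ_completion F mu) s &
    forall x, `|f x| <= L -> `|f x - s x| <= d.
Proof.
move=> sF mf L0 d0; have [fP _] := PJ_subfield chA hPJ sF.
have step m : exists t s, [/\ - L + m%:R * (d / 2) <= t,
    PJ_completion F mu [set x | t < f x], is_simple (PJ_completion F mu) s &
    forall x, - L <= f x <= t -> `|f x - s x| <= d].
  elim: m => [|m [t [s [Lt Pt ss fs]]]].
    have [|t [t1 t2 Pt]] := T1_level chA sF (a := - L) (b := - L + d) mf;
      first lra.
    exists t, (fun=> - L); split=> //; [lra|exact: simple_cst|].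
    by move=> x /andP[? ?]; rewrite ler_norml; apply/andP; split; lra.
  have [|t' [t1 t2 Pt']] := T1_level chA sF (a := t + d / 2) (b := t + d) mf;
    first lra.
  exists t', (fun x => if x \in [set x | t < f x] then t else s x); split=> //.
  - by rewrite -natr1 mulrDl mul1r; lra.
  - by apply: simple_if => //; exact: simple_cst.
  - move=> x /andP[f1 f2]; have [/set_mem/= ?|/negP h] := boolP (x \in _).
      by rewrite ler_norml; apply/andP; split; lra.
    apply: fs; rewrite f1/= leNgt; apply/negP => tf; apply: h.
    exact: mem_set.
have [t [s [Lt _ ss fs]]] := step (Num.truncn (2 * L / (d / 2))).+1.
exists s => // x; rewrite ler_norml => /andP[f1 f2]; apply: fs; rewrite f1/=.
apply: le_trans f2 _; have d20 : 0 < d / 2 by rewrite divr_gt0.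
have := truncnS_gt (2 * L / (d / 2)); rewrite ltr_pdivrMr// => hn.
by move: Lt hn; set z := _%:R * _; lra.
Qed.

Lemma locally_lipschitz_norm : locally_lipschitz (fun x : R => `|x|).
Proof. by move=> K; exists 1 => // x y _ _; rewrite mul1r ler_dist_dist. Qed.

Lemma T1_mod_null F G (f : X -> R) : subfield A F -> subfield A G ->
  (forall E, PJ_completion G mu E -> eq_mod_null (PJ_completion F mu) E) ->
  T1_measurable G mu f ->
  exists2 g, T1_measurable F mu g & null_fun A mu (f - g).
Proof.
move=> sF sG GF mf.
suff [g mg fg] : exists2 g, T1_measurable (PJ_completion F mu) mu g & null_fun
  A mu (f - g).
  by exists g => //; exact: (T1_PJ chA hPJ sF).
have sH := PJ_subfield chA hPJ sF; have [fH HA] := sH.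
have [fP PA] := PJ_subfield chA hPJ sG.
have mf' := T1_comp chA sG locally_lipschitz_norm mf.
(* [p.1] agrees up to a null set with a level set [{|f| > t}]. The level [t] exceeds a bound of
   [|f|] valid off a set of charge below [2 ^ -n], hence the charge of [p.1]; [p.2] is [t]. *)
have /choice[p pP] : forall n, exists p : set X * R,
    [/\ PJ_completion F mu p.1, mu p.1 < 2^-1 ^+ n, 0 <= p.2 & exists2 Z, N Z &
      forall x, ~ Z x -> ~ p.1 x -> `|f x| <= p.2].
  move=> n; have [K [T [K0 GT Tn fT]]] := T1_bounded chA sG mf (half_pow_gt0 R
    n).
  have [|t [t1 t2 Pt]] := T1_level chA sG (a := K) (b := K + 1) mf'; first lra.
  have [E [Z [HE NZ tE]]] := GF _ Pt; have [AZ Z0] := (null_setsP chA hPJ Z).1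
    NZ.
  exists (E, t); split=> //=.
  - apply: le_lt_trans Tn; have := chargeU_le chA (sG.2 _ GT) AZ;
      rewrite Z0 addr0.
    apply: le_trans; apply: (charge_le chA); [exact: HA|by apply: fsetU => //;
      exact: sG.2|].
    move=> x Ex; have [|Zx] := pselect (Z x); [by right|left].
    apply: contrapT => Tx; have /= := (tE x Zx).2 Ex.
    by have := fT x Tx; lra.
  - lra.
  - exists Z => // x Zx Ex; rewrite leNgt; apply/negP => tx; apply: Ex.
    exact/(tE x Zx).
(* Intersecting makes the exceptional sets decrease; the running maximum [M n] then bounds [|f|] off
   [T n], up to a null set. *)
pose fix T n := if n is n'.+1 then T n' `&` (p n'.+1).1 else (p 0%N).1.
pose fix M n := if n is n'.+1 then Order.max (M n') (p n'.+1).2 else (p 0%N).2.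
have M0 n : 0 <= M n.
  elim: n => [|n IHn] /=; first by case: (pP 0%N).
  by rewrite le_max IHn.
have /choice[s sP] : forall n, exists s, is_simple (PJ_completion F mu) s /\
    exists2 Z, N Z & forall x, ~ Z x -> `|f x| <= M n ->
      `|f x - s x| <= 2^-1 ^+ n.
  move=> n; have [s ss fs] := T1_range_approx sG mf (M0 n) (half_pow_gt0 R n).
  have [s' [Z [ss' NZ sZ]]] := simple_mod_null fP fH GF ss.
  by exists s'; split=> //; exists Z => // x Zx; rewrite -sZ//; exact: fs.
have HT n : PJ_completion F mu (T n).
  elim: n => [|n IHn] /=; first by case: (pP 0%N).
  by apply: (fsetI fH IHn); case: (pP n.+1).
have TM n : exists2 Z, N Z & forall x, ~ Z x -> ~ T n x -> `|f x| <= M n.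
  elim: n => [|n [Z NZ fZ]] /=; first by case: (pP 0%N).
  have [_ _ _ [Y NY fY]] := pP n.+1.
  exists (Z `|` Y); first exact: (null_setU chA hPJ).
  move=> x /not_orP[/fZ fx /fY fx'] /not_andP[/fx|/fx'] fM;
    rewrite le_max fM ?orbT//.
apply: (@T1_clip_limit _ f s T sH) => //.
- by move=> n; case: (sP n).
- by move=> n x [].
- move=> n; have [Hp pn _ _] := pP n; apply: le_lt_trans pn.
  apply: (charge_le chA); [exact: HA|exact: HA|].
  by case: n {Hp} => [|n] //= x [].
- move=> n; have [Z NZ fZ] := TM n; have [_ [Y NY fY]] := sP n.
  exists (Z `|` Y); first exact: (null_setU chA hPJ).
  by move=> x /not_orP[/fZ fx /fY fx'] /fx.
Qed.

End ModuloNull.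

(** * Quotient spaces *)

Section Quotient.
Variables (R : realType) (V : lmodType R) (null : set V).
Hypothesis null0 : null 0.
Hypothesis null_lin : forall (a : R) u v, null u -> null v -> null (a *: u + v).

Lemma nullN u : null u -> null (- u).
Proof. by move=> /(null_lin (-1))/(_ null0); rewrite scaleN1r addr0. Qed.

Lemma nullD u v : null u -> null v -> null (u + v).
Proof. by rewrite -{2}(scale1r u); exact: null_lin. Qed.

Lemma null_trans v u w : null (u - v) -> null (v - w) -> null (u - w).
Proof. by move=> uv vw; rewrite -(subrKA v); exact: nullD. Qed.

Lemma null_sym u v : null (u - v) -> null (v - u).
Proof. by move=> /nullN; rewrite opprB. Qed.

Lemma null_subD u u' v v' : null (u - u') -> null (v - v') ->
  null ((u + v) - (u' + v')).
Proof. by move=> uu vv; rewrite opprD addrACA; exact: nullD. Qed.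

Lemma null_scale a u u' : null (u - u') -> null (a *: u - a *: u').
Proof. by move=> uu; rewrite -scalerBr -[_ *: _]addr0; exact: null_lin. Qed.

Section pseudometric.
Variables (L : set V) (d : V -> V -> R).
Hypothesis L_lin : forall (a : R) u v, L u -> L v -> L (a *: u + v).
Hypothesis L0 : L 0.
Hypothesis d_eq0 : forall u v, L u -> L v -> d u v = 0 <-> null (u - v).
Hypothesis d_congr : forall u v u' v', L u -> L v -> L u' -> L v' ->
  null ((u - v) - (u' - v')) -> d u v = d u' v'.

Let LD u v : L u -> L v -> L (u + v).
Proof. by rewrite -{2}(scale1r u); exact: L_lin. Qed.

Let LZ a u : L u -> L (a *: u).
Proof. by move=> Lu; rewrite -[_ *: _]addr0; exact: L_lin. Qed.

Lemma qclassP u v : L u -> qclass L d u v <-> L v /\ null (u - v).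
Proof. by move=> Lu; split=> -[Lv uv]; split=> //; exact/d_eq0. Qed.

Lemma qclass_refl u : L u -> qclass L d u u.
Proof. by move=> Lu; apply/qclassP => //; rewrite subrr. Qed.

Lemma qclass_eq u v : L u -> L v -> qclass L d u = qclass L d v <-> null (u -
  v).
Proof.
move=> Lu Lv; split=> [uv|uv].
  have : qclass L d v v by exact: qclass_refl.
  by rewrite -uv => /(qclassP _ Lu)[].
apply/seteqP; split=> w /qclassP-/(_ _)[]// Lw uw; apply/qclassP => //;
  split=> //.
  exact: null_trans (null_sym uv) uw.
exact: null_trans uv uw.
Qed.

Lemma qaddE u v : L u -> L v ->
  qadd L d (qclass L d u) (qclass L d v) = qclass L d (u + v).
Proof.
move=> Lu Lv; apply/seteqP; split=> [w [u' uu [v' vv]]|w uvw].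
  have [Lu' {}uu] := (qclassP u' Lu).1 uu;
    have [Lv' {}vv] := (qclassP v' Lv).1 vv.
  suff -> : qclass L d (u' + v') = qclass L d (u + v) by [].
  apply/qclass_eq; [exact: LD|exact: LD|exact/null_sym/null_subD].
by exists u; [exact: qclass_refl|exists v => //; exact: qclass_refl].
Qed.

Lemma qscaleE a u : L u -> qscale L d a (qclass L d u) = qclass L d (a *: u).
Proof.
move=> Lu; apply/seteqP; split=> [w [u' uu]|w aw]; last first.
  by exists u => //; exact: qclass_refl.
have [Lu' {}uu] := (qclassP u' Lu).1 uu.
suff -> : qclass L d (a *: u') = qclass L d (a *: u) by [].
by apply/qclass_eq; [exact: LZ|exact: LZ|exact/null_sym/null_scale].
Qed.

Lemma qdistE u v : L u -> L v -> qdist d (qclass L d u) (qclass L d v) = d u v.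
Proof.
move=> Lu Lv; rewrite /qdist (_ : [set _ | _ in _ & _ in _] = [set d u v])
  ?inf1//.
apply/seteqP; split=> [_ [u' uu [v' vv <-]]|_ ->]; last first.
  by exists u; [exact: qclass_refl|exists v => //; exact: qclass_refl].
have [Lu' {}uu] := (qclassP u' Lu).1 uu;
  have [Lv' {}vv] := (qclassP v' Lv).1 vv.
rewrite /=; apply: d_congr => //; apply: null_subD; first exact: null_sym.
by rewrite -opprD; apply/nullN/null_sym.
Qed.

End pseudometric.

(** Both relations are congruence modulo [null], which gives injectivity and the algebra; the last
    hypothesis is surjectivity. *)
Lemma quotient_iso (L L' : set V) (d d' : V -> V -> R) :
  L `<=` L' -> L 0 -> L' 0 ->
  (forall (a : R) u v, L u -> L v -> L (a *: u + v)) ->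
  (forall (a : R) u v, L' u -> L' v -> L' (a *: u + v)) ->
  (forall u v, L u -> L v -> d u v = d' u v) ->
  (forall u v, L' u -> L' v -> d' u v = 0 <-> null (u - v)) ->
  (forall u v u' v', L' u -> L' v -> L' u' -> L' v' ->
     null ((u - v) - (u' - v')) -> d' u v = d' u' v') ->
  (forall u, L' u -> exists2 v, L v & null (u - v)) ->
  exists Phi, isometric_iso L d L' d' Phi /\
    forall u, L u -> Phi (qclass L d u) = qclass L' d' u.
Proof.
move=> LL' L0 L'0 Llin L'lin dd' d'0 d'c surj.
have d0 u v : L u -> L v -> d u v = 0 <-> null (u - v).
  by move=> Lu Lv; rewrite dd'//; apply: d'0; exact: LL'.
have dc u v u' v' : L u -> L v -> L u' -> L v' ->
    null ((u - v) - (u' - v')) -> d u v = d u' v'.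
  by move=> Lu Lv Lu' Lv' h; rewrite !dd'//; apply: d'c => //; exact: LL'.
have LD u v : L u -> L v -> L (u + v) by rewrite -{2}(scale1r u); exact: Llin.
have LZ a u : L u -> L (a *: u) by move=> Lu; rewrite -[_ *: _]addr0;
  exact: Llin.
(* The union over a class avoids choosing a representative; its members all give the same class in
   [L']. *)
pose Phi U := \bigcup_(u in U) qclass L' d' u.
have PhiE u : L u -> Phi (qclass L d u) = qclass L' d' u.
  move=> Lu; apply/seteqP; split=> [w [v uv]|w uw]; last first.
    by exists u => //; exact: qclass_refl.
  have [Lv {}uv] := (qclassP d0 v Lu).1 uv.
  suff -> : qclass L' d' v = qclass L' d' u by [].
  by apply/(qclass_eq d'0); [exact: LL'|exact: LL'|exact: null_sym].
exists Phi; split=> //; split.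
- split.
  + by move=> _ [u Lu <-]; rewrite PhiE//; exists u => //; exact: LL'.
  + move=> _ _ /set_mem[u Lu <-] /set_mem[v Lv <-]; rewrite !PhiE//.
    by move=> /(qclass_eq d'0 (LL' _ Lu) (LL' _ Lv)) uv; apply/(qclass_eq d0).
  + move=> _ [u L'u <-]; have [v Lv uv] := surj u L'u.
    exists (qclass L d v); first by exists v.
    by rewrite PhiE//; apply/(qclass_eq d'0) => //;
      [exact: LL'|exact: null_sym].
- move=> _ _ [u Lu <-] [v Lv <-]; rewrite (qaddE Llin d0)// !PhiE//;
    last exact: LD.
  by rewrite (qaddE L'lin d'0)//; exact: LL'.
- move=> a _ [u Lu <-]; rewrite (qscaleE Llin L0 d0)// !PhiE//; last exact: LZ.
  by rewrite (qscaleE L'lin L'0 d'0)//; exact: LL'.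
- move=> _ _ [u Lu <-] [v Lv <-]; rewrite !PhiE// (qdistE d0 dc)//.
  by rewrite (qdistE d'0 d'c) ?dd'//; exact: LL'.
Qed.

End Quotient.

(** * Comparison of [F] with the field generated by [F] and the null sets *)

Section Main.
Variables (X : Type) (R : realType) (A : set (set X)) (mu : set X -> R).
Hypotheses (chA : charge_space A mu) (hPJ : PJ_complete A mu).
Variables (F : set (set X)) (p : R).
Hypotheses (sF : subfield A F) (hp : p = 0 \/ 1 <= p).

Local Notation N := (null_sets A mu).
Local Notation B := (field_generated (F `|` N)).

Let sB : subfield A B. Proof. exact: subfield_generated. Qed.
Let fF : field_of_sets F. Proof. by case: sF. Qed.
Let FB : F `<=` B.
Proof. by move=> E FE; apply: sub_field_generated; left. Qed.
Let NB : N `<=` B.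
Proof. by move=> E NE; apply: sub_field_generated; right. Qed.

Lemma Lp0 G : subfield A G -> Lp G mu p 0.
Proof. by move=> sG; apply: (Lp_simple chA sG hp);
  exact: (simple_cst sG.1 (0 : R)). Qed.

Lemma Lp_submod_closed G : subfield A G ->
  GRing.submod_closed (mem (Lp G mu p)).
Proof.
move=> sG; split; first by apply/mem_set; exact: Lp0.
by move=> a f g /set_mem Lf /set_mem Lg; apply/mem_set;
  exact: (Lp_lin chA hPJ sG hp).
Qed.

Lemma Lp_dist_subfield f g : Lp F mu p f -> Lp F mu p g ->
  Lp_dist F mu p f g = Lp_dist B mu p f g.
Proof.
move=> Lf Lg; apply: (Lp_dist_congr chA hPJ sF sB hp) => //.
- exact: (Lp_sub chA hPJ sF sB hp FB).
- exact: (Lp_sub chA hPJ sF sB hp FB).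
- by rewrite subrr; exact: null_fun0.
Qed.

Lemma Lp_dense_subspace :
  dense_subspace (Lp F mu p) (Lp_dist F mu p) (Lp B mu p) (Lp_dist B mu p).
Proof.
split; [exact: (Lp_sub chA hPJ sF sB hp FB)|exact: Lp_submod_closed|exact:
  Lp_dist_subfield|].
move=> f Lf e e0; have [s ss fs] := simple_dense chA hPJ sB hp Lf e0.
have [s' [Z [ss' NZ sZ]]] := simple_mod_null chA hPJ sB.1 fF
  (fun E => @generated_mod_null _ _ _ _ chA hPJ F E fF) ss.
exists s'; first exact: (Lp_simple chA sF hp ss').
have Ls' : Lp B mu p s' by apply: (Lp_simple chA sB hp); exact: is_simpleS ss'.
rewrite -(Lp_dist_congr chA hPJ sB sB hp Lf (Lp_simple chA sB hp ss) Lf Ls')//.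
rewrite opprB addrC subrKA => d d0.
apply: (null_setS chA hPJ) NZ => x /=; apply: contraPP => Zx.
by rewrite -[(_ - _) x]/(s' x - s x) sZ// subrr normr0; lra.
Qed.

Lemma indic_Lp G E : subfield A G -> PJ_completion G mu E ->
  Lp G mu p (\1_E : X -> R).
Proof.
move=> sG GE; apply: (Lp_bounded chA sG hp (K := 1)).
  exact: (indic_T1 chA hPJ sG).
by move=> x; rewrite indicE; case: (x \in E); rewrite ?normr1 ?normr0.
Qed.

(** Indicators of null sets test one direction. For the other, the generated field lies in the
    completion of [F], which has the same T1-measurable functions as [F]. *)
Lemma Lp_eq_iff : Lp F mu p = Lp B mu p <-> N `<=` PJ_completion F mu.
Proof.
split=> [FBE E NE|NF].
  apply: (T1_indic chA sF); apply: Lp_T1 p _ _; rewrite FBE;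
    apply: indic_Lp => //.
  by apply: (sub_PJ_completion chA); exact: NB.
apply/seteqP; split; first exact: (Lp_sub chA hPJ sF sB hp FB).
move=> f Lf; apply: (Lp_transfer chA hPJ sF sB hp _ Lf).
  apply: (T1_PJ chA hPJ sF); apply: (T1_sub chA sB (PJ_subfield chA hPJ sF)).
    apply: field_generated_min; first by case: (PJ_subfield chA hPJ sF).
    by move=> E [|/NF//]; exact: (sub_PJ_completion chA).
  exact: Lp_T1 Lf.
by rewrite subrr; exact: (null_fun0 chA hPJ).
Qed.

(** The inclusion in (b) that always holds. *)
Lemma generated_sub_PJ :
  field_generated (PJ_completion F mu `|` N) `<=` PJ_completion B mu.
Proof.
apply: field_generated_min; first by case: (PJ_subfield chA hPJ sB).
move=> E [|/NB]; first exact: PJ_completion_sub.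
exact: (sub_PJ_completion chA).
Qed.

Lemma iso_completion Phi :
  isometric_iso (Lp F mu p) (Lp_dist F mu p) (Lp B mu p) (Lp_dist B mu p) Phi ->
  (forall f, Lp F mu p f ->
     Phi (qclass (Lp F mu p) (Lp_dist F mu p) f) =
     qclass (Lp B mu p) (Lp_dist B mu p) f) ->
  PJ_completion B mu = field_generated (PJ_completion F mu `|` N).
Proof.
move=> [[_ _ Phi_surj] _ _ _] PhiE; apply/seteqP; split;
  last exact: generated_sub_PJ.
move=> E BE; apply: (mod_null_generated chA hPJ).
have LE := indic_Lp sB BE.
have [|_ [f Lf <-]] := Phi_surj (qclass (Lp B mu p) (Lp_dist B mu p) \1_E).
  by exists \1_E.
rewrite (PhiE _ Lf) => fE.
have : qclass (Lp B mu p) (Lp_dist B mu p) \1_E \1_E.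
  by split; [exact: LE|exact: (Lp_distxx chA hPJ)].
rewrite -fE => -[_ fE0].
have {}fE0 := (Lp_dist_eq0 chA hPJ sB hp (Lp_sub chA hPJ sF sB hp FB Lf) LE).1
  fE0.
(* Where [f] is within [1 / 4] of the indicator it is at least [3 / 4] on [E] and at most [1 / 4]
   elsewhere, so any level between [1 / 3] and [2 / 3] separates the two. *)
have [|t [t1 t2 Pt]] := T1_level chA sF (a := 1 / 3) (b := 2 / 3) (Lp_T1 Lf);
  first lra.
exists [set x | t < f x], [set x | 1 / 4 < `|(f - \1_E) x|]; split.
- exact: Pt.
- by apply: fE0; rewrite divr_gt0.
- move=> x /negP; rewrite -leNgt -[(_ - _) x]/(f x - \1_E x) indicE ler_norml
    => /=.
  clear fE fE0; have [Ex|Ex] := pselect (E x).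
    by rewrite (mem_set Ex) /= => /andP[? ?]; split=> [_|_]; [lra|exact: Ex].
  by rewrite (memNset Ex) subr0 => /andP[? ?]; split=> ?; [case: Ex|exfalso;
    lra].
Qed.

Lemma completion_iso :
  PJ_completion B mu = field_generated (PJ_completion F mu `|` N) ->
  exists Phi,
    isometric_iso (Lp F mu p) (Lp_dist F mu p) (Lp B mu p) (Lp_dist B mu p) Phi
      /\
    forall f, Lp F mu p f ->
      Phi (qclass (Lp F mu p) (Lp_dist F mu p) f) =
      qclass (Lp B mu p) (Lp_dist B mu p) f.
Proof.
move=> BE; apply: (@quotient_iso R (X -> R) (null_fun A mu)).
- exact: (null_fun0 chA hPJ).
- exact: (null_fun_lin chA hPJ).
- exact: (Lp_sub chA hPJ sF sB hp FB).
- exact: Lp0.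
- exact: Lp0.
- exact: (Lp_lin chA hPJ sF hp).
- exact: (Lp_lin chA hPJ sB hp).
- exact: Lp_dist_subfield.
- by move=> f g; exact: (Lp_dist_eq0 chA hPJ sB hp).
- by move=> f g f' g'; exact: (Lp_dist_congr chA hPJ sB sB hp).
(* Surjectivity is where (b) enters. *)
- move=> f Lf; have [||g mg fg] := @T1_mod_null _ _ _ _ chA hPJ F B f sF sB.
  + rewrite BE => E; apply: (generated_mod_null chA hPJ).
    by case: (PJ_subfield chA hPJ sF).
  + exact: Lp_T1 Lf.
  + by exists g => //; exact: (Lp_transfer chA hPJ sF sB hp mg Lf fg).
Qed.

End Main.

Theorem theorem37 (X : Type) (R : realType) (A : set (set X)) (mu : set X -> R)
    (A' : set (set X)) (p : R)
    (hA : charge_space A mu) (hPJ : PJ_complete A mu)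
    (hA' : field_of_sets A') (hsub : A' `<=` A)
    (hp : p = 0 \/ 1 <= p) :
  let N := null_sets A mu in
  let B := field_generated (A' `|` N) in
  [/\ dense_subspace (Lp A' mu p) (Lp_dist A' mu p)
                     (Lp B mu p) (Lp_dist B mu p),
      Lp A' mu p = Lp B mu p <-> N `<=` PJ_completion A' mu &
      (exists Phi : set (X -> R) -> set (X -> R),
         isometric_iso (Lp A' mu p) (Lp_dist A' mu p)
                       (Lp B mu p) (Lp_dist B mu p) Phi /\
         forall f, Lp A' mu p f ->
           Phi (qclass (Lp A' mu p) (Lp_dist A' mu p) f) =
           qclass (Lp B mu p) (Lp_dist B mu p) f)
      <->
      PJ_completion B mu = field_generated (PJ_completion A' mu `|` N)].
Proof.
move=> N B; have sF : subfield A A' by split.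
split; [exact: Lp_dense_subspace|exact: Lp_eq_iff|split].
- by move=> [Phi [isoPhi PhiE]]; exact: iso_completion isoPhi PhiE.
- exact: completion_iso.
Qed.
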